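(* Let $q$ be a power of a prime $p$ and $K$ an algebraic closure of $\mathbb{F}_q$. The DGZ curve is the only irreducible plane curve over $K$ of degree $d<q^3-q$ which is $\mathrm{PGL}(3,q)$-invariant.
   Context: $\mathrm{PGL}(3,q)$ acts on $\mathrm{PG}(2,K)$; a curve is invariant if every element maps it onto itself. The DGZ curve is the plane curve with affine equation $$\frac{(X^{q^3}-X)(Y^{q}-Y)-(Y^{q^3}-Y)(X^{q}-X)}{(X^{q^2}-X)(Y^q-Y)-(Y^{q^2}-Y)(X^q-X)}=0,$$ where the quotient is an exact polynomial of degree $q^3-q^2$. *)

(* Defs.v *)
From HB Require Import structures.
From mathcomp Require Import all_boot all_order all_algebra.
From mathcomp Require Import mpoly.
Set Implicit Arguments. Unset Strict Implicit. Unset Printing Implicit Defensive.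
Import Order.TTheory GRing.Theory.
Local Open Scope ring_scope.

Section PlaneCurves.
Variable K : fieldType.

Definition pX : {mpoly K[3]} := 'X_(@Ordinal 3 0 isT).
Definition pY : {mpoly K[3]} := 'X_(@Ordinal 3 1 isT).
Definition pZ : {mpoly K[3]} := 'X_(@Ordinal 3 2 isT).

(* det [[Z, X, Y], [Z^a, X^a, Y^a], [Z^b, X^b, Y^b]] *)
Definition moore_det (a b : nat) : {mpoly K[3]} :=
  pZ * (pX ^+ a * pY ^+ b - pY ^+ a * pX ^+ b)
  - pX * (pZ ^+ a * pY ^+ b - pY ^+ a * pZ ^+ b)
  + pY * (pZ ^+ a * pX ^+ b - pX ^+ a * pZ ^+ b).

(* The homogeneous form F of the DGZ curve: F * D(q,q^2) = D(q,q^3), i.e. F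
   is the exact quotient D(q,q^3) / D(q,q^2) (whose dehomogenization Z = 1 is
   the affine equation of the paper).  A plane curve given by a polynomial G
   is the DGZ curve iff G is a nonzero scalar multiple of F. *)
Definition is_DGZ (q : nat) (G : {mpoly K[3]}) : Prop :=
  exists2 c : K, c != 0 & G * moore_det q (q ^ 2) = c *: moore_det q (q ^ 3).

Definition mconstant (G : {mpoly K[3]}) : bool := (msize G <= 1)%N.

Definition mirreducible (F : {mpoly K[3]}) : Prop :=
  ~~ mconstant F /\
  forall G H : {mpoly K[3]}, F = G * H -> mconstant G \/ mconstant H.

Definition in_Fq (q : nat) (a : K) : bool := a ^+ q == a.

Definition mx_subst (A : 'M[K]_3) (F : {mpoly K[3]}) : {mpoly K[3]} :=
  comp_mpoly [tuple (\sum_(j < 3) A i j *: 'X_j) | i < 3] F.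

Definition PGL3q_invariant (q : nat) (F : {mpoly K[3]}) : Prop :=
  forall A : 'M[K]_3, (forall i j, in_Fq q (A i j)) -> \det A != 0 ->
    exists2 lam : K, lam != 0 & mx_subst A F = lam *: F.

End PlaneCurves.

(* Main.v *)
Require Import Defs.
From HB Require Import structures.
From mathcomp Require Import all_boot all_order all_algebra all_field.
From mathcomp Require Import mpoly ring zify.
Set Implicit Arguments. Unset Strict Implicit. Unset Printing Implicit Defensive.
Import Order.TTheory GRing.Theory.
Local Open Scope ring_scope.

(** The form of the DGZ curve is the Dickson invariant C = c^q + V^(q-1), where
    c(X, Y) is the quotient of X Y^(q^2) - X^(q^2) Y by X Y^q - X^q Y and V is
    the product of all Z + a X + b Y with a, b in F_q.

    Uniqueness.  Let F be irreducible and semi-invariant of degree d < q^3 - q.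
    F does not vanish identically on an F_q-rational line, so every reflection,
    fixing such a line pointwise, leaves F itself invariant.  The shears
    X -> X + a Z make P(T) = F(T, 1, 0) a polynomial in T^q, the homotheties one
    in T^(q-1).  If F(1, 0, 0) = 0, the translations T -> T + a make
    (T^q - T)^(q(q-1)) divide P, which has too low a degree, so P = 0; and an
    invariant vanishing on Z = 0 is divisible by the (q-1)-st power of every
    F_q-rational linear form, so it is 0 in degree at most q^3 - q^2.  Hence
    F(1, 0, 0) <> 0, so q^2 and q - 1 divide d, d = q^3 - q^2, and the same
    argument kills F - k C for the k making it vanish at (1, 0, 0).

    Irreducibility.  If C = G H, then G and H have a common zero by elimination
    of Z.  There dC/dZ = 0, which puts the point on an F_q-rational line; move
    this line to Z = 0.  Near (x : y : 0) the curve has the local equation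
    s^q + u Z^(q-1) = 0 up to higher weight, with q and q - 1 coprime, so G and
    H cannot both pass through the point. *)

(** * The Dickson forms *)

Section DicksonForms.
Variables (S : comNzRingType) (q : nat).
Implicit Types x y z : S.

(* lin2 * quot2 = x y^(q^2) - x^(q^2) y, and lin2 * orbit3 is the Moore determinant
   of (z, x, y), i.e. orbit3 is the product of all z + a x + b y with a, b in F_q. *)
Definition lin2 x y := x * y ^+ q - x ^+ q * y.
Definition quot2 x y := \sum_(i < q.+1) x ^+ (q.-1 * (q - i)) * y ^+ (q.-1 * i).
Definition orbit3 x y z :=
  z ^+ (q ^ 2) - quot2 x y * z ^+ q + lin2 x y ^+ q.-1 * z.
Definition dickson3 x y z := quot2 x y ^+ q + orbit3 x y z ^+ q.-1.
Definition moore3 (a b : nat) x y z :=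
  z * (x ^+ a * y ^+ b - y ^+ a * x ^+ b)
  - x * (z ^+ a * y ^+ b - y ^+ a * z ^+ b)
  + y * (z ^+ a * x ^+ b - x ^+ a * z ^+ b).

Hypothesis q_gt0 : (0 < q)%N.

(** With a = x^(q-1) and b = y^(q-1), [quot2] is the geometric sum (a^(q+1) - b^(q+1)) / (a - b),
    and [lin2] is -xy(a - b). *)
Lemma lin2_quot2 x y :
  lin2 x y * quot2 x y = x * y ^+ (q ^ 2) - x ^+ (q ^ 2) * y.
Proof.
have -> : quot2 x y = \sum_(i < q.+1) (x ^+ q.-1) ^+ (q.+1.-1 - i) * (y ^+ q.-1) ^+ i.
  by apply: eq_bigr => i _; rewrite !exprM.
have -> : lin2 x y = - (x * y) * (x ^+ q.-1 - y ^+ q.-1).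
  by rewrite /lin2 -[X in x ^+ X](prednK q_gt0) -[X in y ^+ X](prednK q_gt0) !exprS; ring.
rewrite -mulrA -subrXX -!exprM.
have -> : (q ^ 2 = (q.-1 * q.+1).+1)%N by case: q q_gt0 => // k _ /=; lia.
by rewrite !exprS; ring.
Qed.

Hypothesis q_pchar : [pchar S].-nat q.

Lemma exprqD x y : (x + y) ^+ q = x ^+ q + y ^+ q.
Proof. exact: exprDn_pchar. Qed.

Lemma exprqN x : (- x) ^+ q = - x ^+ q.
Proof. exact: exprNn_pchar. Qed.

Lemma exprqB x y : (x - y) ^+ q = x ^+ q - y ^+ q.
Proof. by rewrite exprqD exprqN. Qed.

Lemma pcharX k : [pchar S].-nat (q ^ k)%N.
Proof. by rewrite pnatX q_pchar. Qed.

Lemma orbit3_moore x y z : lin2 x y * orbit3 x y z = moore3 q (q ^ 2) x y z.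
Proof.
have E : lin2 x y ^+ q = x ^+ q * y ^+ (q ^ 2) - x ^+ (q ^ 2) * y ^+ q.
  by rewrite exprqB !exprMn -!exprM.
rewrite /orbit3 mulrDr mulrBr.
rewrite (_ : lin2 x y * (lin2 x y ^+ _ * z) = lin2 x y ^+ q * z); last first.
  by rewrite mulrA -exprS prednK.
rewrite E mulrA lin2_quot2 /lin2 /moore3; ring.
Qed.

End DicksonForms.

(** As [lin2] times [orbit3] is the Moore determinant for (q, q^2), the left side is l (c^q v +
    v^q); expanding v^q by Frobenius cancels the terms in z^(q^2). *)
Lemma dickson3_moore (S : idomainType) (q : nat) (x y z : S) :
  (0 < q)%N -> [pchar S].-nat q -> lin2 q x y != 0 ->
  dickson3 q x y z * moore3 q (q ^ 2) x y z = moore3 q (q ^ 3) x y z.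
Proof.
move=> q_gt0 q_pchar nz.
set l := lin2 q x y; set c := quot2 q x y; set v := orbit3 q x y z.
have El : l ^+ q = x ^+ q * y ^+ (q ^ 2) - x ^+ (q ^ 2) * y ^+ q.
  by rewrite exprqB // !exprMn -!exprM.
have El2 : l ^+ (q ^ 2) = x ^+ (q ^ 2) * y ^+ (q ^ 3) - x ^+ (q ^ 3) * y ^+ (q ^ 2).
  by rewrite exprDn_pchar ?pcharX // exprNn_pchar ?pcharX // !exprMn -!exprM.
have Ec : l * c = x * y ^+ (q ^ 2) - x ^+ (q ^ 2) * y by exact: lin2_quot2.
have Ecq : l ^+ q * c ^+ q = x ^+ q * y ^+ (q ^ 3) - x ^+ (q ^ 3) * y ^+ q.
  by rewrite -exprMn Ec exprqB // !exprMn -!exprM (mulnC (q ^ 2)%N q).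
have Evq : v ^+ q = z ^+ (q ^ 3) - c ^+ q * z ^+ (q ^ 2) + (l ^+ q) ^+ q.-1 * z ^+ q.
  by rewrite /v /orbit3 exprqD // exprqB // !exprMn -!exprM -/l -/c (mulnC q.-1) (mulnC (q ^ 2)%N q).
rewrite -(orbit3_moore q_gt0 q_pchar) -/l -/v mulrCA /dickson3 -/c -/v [(_ + _) * v]mulrDl -exprSr prednK //.
(* The extra factor l^q removes the quotient c: by [Ecq], l^q c^q is a difference of two
   monomials. *)
rewrite Evq; apply: (mulfI (expf_neq0 q nz)); rewrite -/l.
have -> : l ^+ q * (l * (c ^+ q * v + (z ^+ (q ^ 3) - c ^+ q * z ^+ (q ^ 2) + (l ^+ q) ^+ q.-1 * z ^+ q)))
   = l ^+ q * c ^+ q * (l * v) + l ^+ q * (l * z ^+ (q ^ 3))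
     - (l ^+ q * c ^+ q) * (l * z ^+ (q ^ 2)) + l * (l ^+ q * (l ^+ q) ^+ q.-1) * z ^+ q by ring.
rewrite (_ : l ^+ q * (l ^+ q) ^+ q.-1 = l ^+ (q ^ 2)); last by rewrite -exprS prednK // -exprM.
rewrite El2.
rewrite orbit3_moore // Ecq El /l /lin2 /moore3; ring.
Qed.

(** * Evaluation of ternary forms *)

Local Notation i0 := (@Ordinal 3 0 isT).
Local Notation i1 := (@Ordinal 3 1 isT).
Local Notation i2 := (@Ordinal 3 2 isT).

Lemma big_ord3 (T : Type) (idx : T) (op : Monoid.law idx) (E : 'I_3 -> T) :
  \big[op/idx]_(i < 3) E i = op (op (E i0) (E i1)) (E i2).
Proof.
rewrite !big_ord_recr big_ord0 /= Monoid.mul1m.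
by congr (op (op (E _) (E _)) (E _)); apply: val_inj.
Qed.

Lemma det3 (R : comNzRingType) (A : 'M[R]_3) :
  \det A = A i0 i0 * (A i1 i1 * A i2 i2 - A i1 i2 * A i2 i1)
         - A i0 i1 * (A i1 i0 * A i2 i2 - A i1 i2 * A i2 i0)
         + A i0 i2 * (A i1 i0 * A i2 i1 - A i1 i1 * A i2 i0).
Proof.
(* Reading entries through natural number indices identifies ordinals that differ only in their
   bound proofs. *)
pose B i j : R := A (inord i) (inord j).
have E i j : A i j = B i j by rewrite /B !inord_val.
rewrite (expand_det_row _ i0) big_ord3 /cofactor.
rewrite !(expand_det_row _ ord0) !big_ord_recl !big_ord0 /cofactor !det_mx11 !mxE.
rewrite !E /= /bump /=; ring.
Qed.

Lemma rmorph_quot2 (S T : comNzRingType) (g : {rmorphism S -> T}) q x y :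
  g (quot2 q x y) = quot2 q (g x) (g y).
Proof. by rewrite rmorph_sum; apply: eq_bigr => i _; rewrite rmorphM !rmorphXn. Qed.

Lemma rmorph_lin2 (S T : comNzRingType) (g : {rmorphism S -> T}) q x y :
  g (lin2 q x y) = lin2 q (g x) (g y).
Proof. by rewrite rmorphB !rmorphM !rmorphXn. Qed.

Lemma rmorph_orbit3 (S T : comNzRingType) (g : {rmorphism S -> T}) q x y z :
  g (orbit3 q x y z) = orbit3 q (g x) (g y) (g z).
Proof.
by rewrite rmorphD rmorphB !rmorphM !rmorphXn rmorph_quot2 rmorph_lin2.
Qed.

Lemma rmorph_dickson3 (S T : comNzRingType) (g : {rmorphism S -> T}) q x y z :
  g (dickson3 q x y z) = dickson3 q (g x) (g y) (g z).
Proof. by rewrite rmorphD !rmorphXn rmorph_quot2 rmorph_orbit3. Qed.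

Lemma rmorph_moore3 (S T : comNzRingType) (g : {rmorphism S -> T}) a b x y z :
  g (moore3 a b x y z) = moore3 a b (g x) (g y) (g z).
Proof. by rewrite rmorphD rmorphB !rmorphM !rmorphB !rmorphM !rmorphXn. Qed.

Section Evaluation.
Variables (K : fieldType) (S : comNzRingType) (f : {rmorphism K -> S}).
Implicit Types (x y z : S) (F G : {mpoly K[3]}).

(** The target is any commutative ring over K, so that the same evaluation serves for points, for
    restrictions to lines and for generic coordinates. *)
Definition ev x y z F : S := mmap f (fun i : 'I_3 => nth 0 [:: x; y; z] i) F.

HB.instance Definition _ x y z := GRing.RMorphism.copy (ev x y z)
  (mmap f (fun i : 'I_3 => nth 0 [:: x; y; z] i)).

Lemma evZ x y z c F : ev x y z (c *: F) = f c * ev x y z F.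
Proof. exact: mmapZ. Qed.

Lemma evC x y z c : ev x y z c%:MP = f c.
Proof. exact: mmapC. Qed.

Lemma ev_pX x y z : ev x y z (pX K) = x.
Proof. by rewrite /ev mmapX mmap1U. Qed.
Lemma ev_pY x y z : ev x y z (pY K) = y.
Proof. by rewrite /ev mmapX mmap1U. Qed.
Lemma ev_pZ x y z : ev x y z (pZ K) = z.
Proof. by rewrite /ev mmapX mmap1U. Qed.

Lemma ev_sum x y z F :
  ev x y z F =
  \sum_(m <- msupp F) f F@_m * (x ^+ m i0 * y ^+ m i1 * z ^+ m i2).
Proof. by apply: eq_bigr => m _; rewrite /mmap1 big_ord3. Qed.

Lemma homog_mdeg3 d F m :
  F \is d.-homog -> m \in msupp F -> (m i0 + m i1 + m i2)%N = d.
Proof. by move=> /dhomogP Fd /Fd <-; rewrite /= mdegE big_ord3. Qed.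

Lemma ev_homog d x y z t F :
  F \is d.-homog -> ev (t * x) (t * y) (t * z) F = t ^+ d * ev x y z F.
Proof.
move=> Fd; rewrite !ev_sum mulr_sumr.
rewrite big_seq [RHS]big_seq; apply: eq_bigr => m /(homog_mdeg3 Fd) <-.
by rewrite !exprMn !exprD; ring.
Qed.

Lemma ev_mx_subst x y z A F :
  ev x y z (mx_subst A F) =
  ev (f (A i0 i0) * x + f (A i0 i1) * y + f (A i0 i2) * z)
     (f (A i1 i0) * x + f (A i1 i1) * y + f (A i1 i2) * z)
     (f (A i2 i0) * x + f (A i2 i1) * y + f (A i2 i2) * z) F.
Proof.
rewrite /mx_subst comp_mpolyEX rmorph_sum ev_sum; apply: eq_bigr => m _.
rewrite /= evZ comp_mpolyX big_ord3 !rmorphM !rmorphXn /= !tnth_mktuple.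
by rewrite !big_ord3 !rmorphD /= !evZ !ev_pX !ev_pY !ev_pZ.
Qed.

Lemma ev_dickson3 q x y z :
  ev x y z (dickson3 q (pX K) (pY K) (pZ K)) = dickson3 q x y z.
Proof. by rewrite rmorph_dickson3 /= ev_pX ev_pY ev_pZ. Qed.

End Evaluation.

Lemma rmorph_ev (K : fieldType) (S T : comNzRingType) (f : {rmorphism K -> S})
    (g : {rmorphism S -> T}) x y z F :
  g (ev f x y z F) = ev (g \o f) (g x) (g y) (g z) F.
Proof.
rewrite !ev_sum rmorph_sum; apply: eq_bigr => m _.
by rewrite !rmorphM !rmorphXn.
Qed.

Lemma eq_ev (K : fieldType) (S : comNzRingType) (f g : {rmorphism K -> S}) x y z F :
  f =1 g -> ev f x y z F = ev g x y z F.
Proof. by move=> e; rewrite !ev_sum; apply: eq_bigr => m _; rewrite e. Qed.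

(** * The DGZ form *)

Lemma rmorph_pchar_nat (R S : nzRingType) (f : {rmorphism R -> S}) q :
  [pchar R].-nat q -> [pchar S].-nat q.
Proof. by apply: sub_in_pnat => p _ /(rmorph_pchar f). Qed.

(** Frobenius powers are additive and fix the coefficients, so the three rows of the Moore matrix
    undergo the same linear map and its determinant factors out. *)
Lemma moore3_linear (S : comNzRingType) (q k : nat)
    (a00 a01 a02 a10 a11 a12 a20 a21 a22 x y z : S) :
  [pchar S].-nat q ->
  all (fun a => a ^+ q == a) [:: a00; a01; a02; a10; a11; a12; a20; a21; a22] ->
  moore3 q (q ^ k) (a00 * x + a01 * y + a02 * z) (a10 * x + a11 * y + a12 * z)
    (a20 * x + a21 * y + a22 * z) =
  (a00 * (a11 * a22 - a12 * a21) - a01 * (a10 * a22 - a12 * a20)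
   + a02 * (a10 * a21 - a11 * a20)) * moore3 q (q ^ k) x y z.
Proof.
move=> q_pchar Ha.
have fix_pow (a : S) : a ^+ q = a -> a ^+ (q ^ k) = a.
  by move=> e; elim: k => // k IH; rewrite expnSr exprM IH.
have lin_pow (a b c : S) : a ^+ q = a -> b ^+ q = b -> c ^+ q = c ->
    (a * x + b * y + c * z) ^+ q = a * x ^+ q + b * y ^+ q + c * z ^+ q /\
    (a * x + b * y + c * z) ^+ (q ^ k) =
      a * x ^+ (q ^ k) + b * y ^+ (q ^ k) + c * z ^+ (q ^ k).
  move=> ea eb ec; split; first by rewrite !exprDn_pchar // !exprMn ea eb ec.
  by rewrite !exprDn_pchar ?pnatX ?q_pchar // !exprMn (fix_pow _ ea) (fix_pow _ eb) (fix_pow _ ec).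
move: Ha => /= /and5P[/eqP h1 /eqP h2 /eqP h3 /eqP h4].
move=> /and5P[/eqP h5 /eqP h6 /eqP h7 /eqP h8 /andP[/eqP h9 _]].
rewrite /moore3.
have [-> ->] := lin_pow _ _ _ h1 h2 h3.
have [-> ->] := lin_pow _ _ _ h4 h5 h6.
have [-> ->] := lin_pow _ _ _ h7 h8 h9.
by move: (x ^+ q) (y ^+ q) (z ^+ q) (x ^+ _) (y ^+ _) (z ^+ _) => *; ring.
Qed.

Lemma ev_id (K : fieldType) (F : {mpoly K[3]}) :
  ev (@mpolyC 3 K) (pX K) (pY K) (pZ K) F = F.
Proof.
rewrite ev_sum [RHS]mpolyE; apply: eq_bigr => m _.
by rewrite mul_mpolyC [in RHS]mpolyXE_id big_ord3.
Qed.

Lemma quot2_at0 (S : comNzRingType) q (y : S) : (1 < q)%N ->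
  quot2 q 0 y = y ^+ (q.-1 * q).
Proof.
move=> q_gt1; rewrite /quot2 big_ord_recr /= subnn muln0 expr0 mul1r.
rewrite big1 ?add0r // => i _; rewrite expr0n muln_eq0 -subn1 subn_eq0 subn_eq0.
by rewrite leqNgt q_gt1 leqNgt ltn_ord mul0r.
Qed.

Section DGZ.
Variables (K : fieldType) (q : nat).
Hypotheses (q_gt1 : (1 < q)%N) (q_pchar : [pchar K].-nat q).

Let q_gt0 : (0 < q)%N. Proof. exact: ltnW. Qed.

Definition dgz : {mpoly K[3]} := dickson3 q (pX K) (pY K) (pZ K).

Lemma mpoly_pchar_nat : [pchar {mpoly K[3]}].-nat q.
Proof. exact: (rmorph_pchar_nat (@mpolyC 3 K)). Qed.

Lemma lin2_XY_neq0 : lin2 q (pX K) (pY K) != 0.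
Proof.
apply/eqP => /(congr1 (ev (@polyC K) 'X 1 0)).
rewrite rmorph_lin2 rmorph0 /= ev_pX ev_pY /lin2 expr1n !mulr1 => /(congr1 (fun p : {poly K} => p`_1)).
rewrite coefB coefX coefXn coef0 (_ : (1 == q)%N = false) ?subr0; last by lia.
by move/eqP; rewrite oner_eq0.
Qed.

Lemma moore_det_neq0 : moore_det K q (q ^ 2) != 0.
Proof.
rewrite -[moore_det K _ _](orbit3_moore q_gt0 mpoly_pchar_nat) mulf_neq0 ?lin2_XY_neq0 //.
apply/eqP => /(congr1 (ev idfun 0 0 1)).
rewrite rmorph_orbit3 rmorph0 /= ev_pX ev_pY ev_pZ /orbit3 /lin2 quot2_at0 //.
rewrite mul0r mulr0 subr0 !expr1n expr0n muln_eq0 -subn1 subn_eq0 leqNgt q_gt1.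
rewrite (_ : (q == 0)%N = false) ?[0 ^+ (_ - _)]expr0n ?subn_eq0 ?[(q <= 1)%N]leqNgt ?q_gt1; last by lia.
by rewrite !mul0r subr0 addr0 => /eqP; rewrite oner_eq0.
Qed.

Lemma dgz_moore : dgz * moore_det K q (q ^ 2) = moore_det K q (q ^ 3).
Proof. by apply: dickson3_moore; rewrite ?mpoly_pchar_nat ?lin2_XY_neq0. Qed.

(** Cancelling the non-zero Moore determinant replaces the quotient by an explicit form. *)
Lemma is_DGZP F : is_DGZ q F <-> exists2 c : K, c != 0 & F = c *: dgz.
Proof.
split=> -[c nz e]; exists c => //; last by rewrite e -scalerAl dgz_moore.
by apply: (mulIf moore_det_neq0); rewrite e -scalerAl dgz_moore.
Qed.

Lemma dgz_homog : dgz \is (q ^ 3 - q ^ 2)%N.-homog.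
Proof.
have hU (i : 'I_3) : ('X_i : {mpoly K[3]}) \is 1.-homog by rewrite dhomogX /= mdeg1.
have hX i k : ('X_i ^+ k : {mpoly K[3]}) \is k.-homog.
  by rewrite -[X in X.-homog]mul1n dhomogMn.
have cast d e (F : {mpoly K[3]}) : d = e -> F \is d.-homog -> F \is e.-homog by move=> ->.
have hc : quot2 q (pX K) (pY K) \is (q.-1 * q)%N.-homog.
  apply: rpred_sum => i _.
  apply: (@cast (q.-1 * (q - i) + q.-1 * i)%N); last by rewrite dhomogM ?hX.
  by rewrite -mulnDr subnK // -ltnS.
have hl : lin2 q (pX K) (pY K) \is q.+1.-homog.
  apply: rpredB; first by apply: (@cast (1 + q)%N) => //; rewrite dhomogM ?hX ?hU.
  by apply: (@cast (q + 1)%N); [rewrite addn1 | rewrite dhomogM ?hX ?hU].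
have ho : orbit3 q (pX K) (pY K) (pZ K) \is (q ^ 2)%N.-homog.
  apply: rpredD; first (apply: rpredB; first exact: hX).
    apply: (@cast (q.-1 * q + q)%N); last by rewrite dhomogM ?hX.
    by case: (q) q_gt0 => // k _ /=; lia.
  apply: (@cast (q.+1 * q.-1 + 1)%N); last by rewrite dhomogM ?hU ?dhomogMn.
  by case: (q) q_gt0 => // k _ /=; lia.
have E3 : (q ^ 3 - q ^ 2 = q ^ 2 * q.-1)%N by case: (q) q_gt0 => // k _ /=; lia.
apply: rpredD; last by rewrite E3 dhomogMn.
by apply: (@cast (q.-1 * q * q)%N); rewrite ?dhomogMn // E3; lia.
Qed.

(** Both Moore determinants are multiplied by det A, so their quotient is fixed exactly and not only
    up to a scalar. *)
Lemma mx_subst_dgz (A : 'M[K]_3) :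
  (forall i j, in_Fq q (A i j)) -> \det A != 0 -> mx_subst A dgz = dgz.
Proof.
move=> AFq nzA; rewrite -[LHS]ev_id ev_mx_subst.
set x := (X in ev _ X); set y := (X in ev _ _ X); set z := (X in ev _ _ _ X).
have Em k : ev (@mpolyC 3 K) x y z (moore_det K q (q ^ k)) =
    (\det A)%:MP * moore_det K q (q ^ k).
  rewrite (rmorph_moore3 (ev _ _ _ _)) /= ev_pX ev_pY ev_pZ.
  rewrite det3 !(rmorphD, rmorphN, rmorphM) /=.
  apply: moore3_linear; first exact: mpoly_pchar_nat.
  by rewrite /= -!rmorphXn /= !(eqP (AFq _ _)) !eqxx.
have nzD : (\det A)%:MP * moore_det K q (q ^ 2) != 0.
  by rewrite mulf_neq0 ?moore_det_neq0 // mpolyC_eq0.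
apply: (mulIf nzD); rewrite -[in LHS]Em -rmorphM /= dgz_moore Em.
by rewrite mulrCA dgz_moore.
Qed.

Lemma dgz_invariant : PGL3q_invariant q dgz.
Proof.
by move=> A AFq nzA; exists 1; rewrite ?oner_eq0 // scale1r mx_subst_dgz.
Qed.

End DGZ.

(** * Univariate polynomials *)

Section Translations.
Variables (R : idomainType) (s : seq R) (U : {poly R}).
Hypotheses (s_uniq : uniq s) (s0 : 0 \in s) (U_monic : U \is monic).
Hypotheses (sizeU : size U = (size s).+1) (U0 : U.[0] = 0).
Hypothesis U_inv : {in s, forall a, U \Po ('X + a%:P) = U}.

(** Induction on the degree: Q - Q(0) vanishes on s, hence so does its remainder modulo U, which is
    too short to have that many roots. The quotient by U is again invariant. *)
Lemma translation_invariant_comp (Q : {poly R}) :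
  {in s, forall a, Q \Po ('X + a%:P) = Q} -> exists g, Q = g \Po U.
Proof.
have valE (P : {poly R}) a : P \Po ('X + a%:P) = P -> P.[a] = P.[0].
  by move=> e; rewrite -{2}e horner_comp hornerD hornerX hornerC add0r.
have [n] := ubnP (size Q); elim: n Q => // n IH Q leQn Qinv.
pose Q0 := Q - Q.[0]%:P.
have eQ0 := Pdiv.RingMonic.rdivp_eq U_monic Q0.
set D := Pdiv.Ring.rdivp Q0 U in eQ0; set r := Pdiv.Ring.rmodp Q0 U in eQ0.
have Ua a : a \in s -> U.[a] = 0 by move=> /U_inv/valE ->.
have r0 : r = 0.
  apply/eqP; apply: contraT => nzr; have := max_poly_roots nzr _ s_uniq.
  rewrite ltnNge -ltnS -sizeU Pdiv.Ring.ltn_rmodpN0 ?monic_neq0 //; apply.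
  apply/allP => a sa; rewrite rootE -(addKr (D * U).[a] r.[a]) -hornerD -eQ0.
  by rewrite hornerM Ua // mulr0 oppr0 add0r hornerD hornerN hornerC (valE _ _ (Qinv _ sa)) subrr.
rewrite r0 addr0 in eQ0.
have [D0|nzD] := eqVneq D 0.
  exists Q.[0]%:P; rewrite comp_polyC; apply/eqP; rewrite -subr_eq0.
  by rewrite -/Q0 eQ0 D0 mul0r.
have sz : (size D < size Q)%N.
  have nzQ0 : Q0 != 0 by rewrite eQ0 mulf_neq0 // monic_neq0.
  have sizeQ0 : (size Q0 <= size Q)%N.
    rewrite (leq_trans (size_polyD _ _)) // size_polyN geq_max leqnn size_polyC.
    case: eqP => //= nz; rewrite lt0n size_poly_eq0.
    by apply/eqP => e; apply: nz; rewrite e horner0.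
  apply: leq_trans sizeQ0; rewrite eQ0 size_Mmonic // sizeU addnS /= -addn1 leq_add2l.
  by case: (s) s0.
have [|a sa|g eg] := IH D; first by apply: leq_trans sz _; rewrite -ltnS.
  apply: (mulIf (monic_neq0 U_monic)); rewrite -eQ0 -{1}(U_inv sa) -comp_polyM -eQ0.
  by rewrite rmorphB /= comp_polyC Qinv.
exists (g * 'X + Q.[0]%:P).
by rewrite comp_polyD comp_polyM comp_polyX comp_polyC -eg -eQ0 subrK.
Qed.

End Translations.

(** * Root multiplicities and vanishing criteria *)

Section FieldPolynomials.
Variable K : fieldType.
Implicit Types (P : {poly K}) (s : seq K).

Lemma prod_XsubC_exp_dvdp P s k : uniq s ->
  {in s, forall a, ('X - a%:P) ^+ k %| P} ->
  \prod_(a <- s) ('X - a%:P) ^+ k %| P.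
Proof.
elim: s => [|a s IH] /=; first by rewrite big_nil dvd1p.
move=> /andP[a_s Us] dv; rewrite big_cons Gauss_dvdp; last first.
  rewrite big_seq; elim/big_rec: _ => [|b r sb cop]; first exact: coprimep1.
  rewrite coprimepMr cop andbT coprimep_expl // coprimep_expr // coprimep_XsubC root_XsubC.
  by apply: contra a_s => /eqP <-.
by rewrite dv ?mem_head // IH // => b sb; rewrite dv // in_cons sb orbT.
Qed.

Lemma size_gt_root_multiplicities P s k : uniq s -> P != 0 ->
  {in s, forall a, ('X - a%:P) ^+ k %| P} -> (size s * k < size P)%N.
Proof.
move=> Us nzP /(prod_XsubC_exp_dvdp Us)/(dvdp_leq nzP); apply: leq_trans.
have -> : \prod_(a <- s) ('X - a%:P) ^+ k = (\prod_(a <- s) ('X - a%:P)) ^+ k.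
  by rewrite prodrXl.
by rewrite polySpred ?expf_neq0 ?monic_neq0 ?monic_prod_XsubC // size_exp size_prod_XsubC.
Qed.

Lemma coef_comp_scaleX P c i : (P \Po (c *: 'X))`_i = c ^+ i * P`_i.
Proof.
rewrite comp_polyE coef_sum; under eq_bigr do rewrite exprZn scalerA coefZ coefXn.
have [lt|le] := ltnP i (size P).
  rewrite (bigD1 (Ordinal lt)) //= eqxx mulr1 mulrC big1 ?addr0 // => j ne.
  by rewrite (_ : (i == j)%N = false) ?mulr0 //; apply/eqP => e; case/eqP: ne; apply: val_inj.
rewrite nth_default // mulr0 big1 // => j _.
by rewrite (_ : (i == j)%N = false) ?mulr0 //; apply/eqP => e; move: (ltn_ord j); rewrite -e ltnNge le.
Qed.

End FieldPolynomials.

Lemma horner_ev (K : fieldType) (p1 p2 p3 : {poly K}) F x :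
  (ev (@polyC K) p1 p2 p3 F).[x] = ev idfun p1.[x] p2.[x] p3.[x] F.
Proof.
rewrite -/(horner_eval x _) rmorph_ev; apply: eq_ev => c /=.
by rewrite /horner_eval hornerC.
Qed.

Lemma comp_ev (K : fieldType) (p1 p2 p3 u : {poly K}) F :
  ev (@polyC K) p1 p2 p3 F \Po u = ev (@polyC K) (p1 \Po u) (p2 \Po u) (p3 \Po u) F.
Proof. by rewrite rmorph_ev; apply: eq_ev => c /=; rewrite comp_polyC. Qed.

Lemma closed_poly_eq0 (K : closedFieldType) (P : {poly K}) :
  (forall x, P.[x] = 0) -> P = 0.
Proof.
move=> P0; apply/eqP; apply: contraT => /closed_nonrootP[x].
by rewrite rootE P0 eqxx.
Qed.

Lemma mnm3P (m m' : 'X_{1..3}) : m i0 = m' i0 -> m i1 = m' i1 -> m i2 = m' i2 -> m = m'.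
Proof.
move=> e0 e1 e2; apply/mnmP => -[[|[|[|//]]] h].
- by rewrite (bool_irrelevance h isT).
- by rewrite (bool_irrelevance h isT).
- by rewrite (bool_irrelevance h isT).
Qed.

(* Kronecker substitution: X, Y, Z -> T, T^N, T^(N^2) separates monomials of degree < N. *)
Lemma ev_eq0 (K : closedFieldType) (F : {mpoly K[3]}) :
  (forall x y z, ev idfun x y z F = 0) -> F = 0.
Proof.
move=> F0; pose N := msize F.
have bnd m : m \in msupp F -> [/\ m i0 < N, m i1 < N & m i2 < N]%N.
  move=> /msize_mdeg_lt; rewrite mdegE big_ord3 /= -/N => lt.
  by split; apply: leq_ltn_trans lt; lia.
pose code (m : 'X_{1..3}) := (m i0 + N * m i1 + N ^ 2 * m i2)%N.
have code_inj m m' : m \in msupp F -> m' \in msupp F -> code m = code m' -> m = m'.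
  move=> /bnd[h0 h1 h2] /bnd[h0' h1' h2']; rewrite /code => e.
  have e' : (m i0 + (m i1 + m i2 * N) * N = m' i0 + (m' i1 + m' i2 * N) * N)%N by lia.
  have N0 : (0 < N)%N by exact: leq_ltn_trans h0.
  have E0 := congr1 (modn^~ N) e'; rewrite /= ![(_ i0 + _)%N]addnC !modnMDl !modn_small // in E0.
  have E1 := congr1 (divn^~ N) e'.
  rewrite /= ![(_ i0 + _)%N]addnC !divnMDl // !(divn_small h0) !(divn_small h0') !addn0 in E1.
  have E2 := congr1 (modn^~ N) E1; rewrite /= ![(_ i1 + _)%N]addnC !modnMDl !modn_small // in E2.
  have E3 := congr1 (divn^~ N) E1.
  rewrite /= ![(_ i1 + _)%N]addnC !divnMDl // !(divn_small h1) !(divn_small h1') !addn0 in E3.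
  exact: mnm3P.
pose P := ev (@polyC K) 'X 'X^N 'X^(N ^ 2) F.
have P0 : P = 0 by apply: closed_poly_eq0 => x; rewrite horner_ev F0.
apply/mpolyP => m; rewrite mcoeff0; have [Fm|] := boolP (m \in msupp F); last first.
  exact: memN_msupp_eq0.
have := congr1 (fun p : {poly K} => p`_(code m)) P0; rewrite /= coef0 => <-.
rewrite /P ev_sum coef_sum (bigD1_seq m) ?msupp_uniq //= big_seq_cond big1 ?addr0.
  by rewrite -!exprM -!exprD coefCM coefXn eqxx mulr1.
move=> m' /andP[Fm' ne]; rewrite -!exprM -!exprD coefCM coefXn.
rewrite [_ == _](_ : _ = false) ?mulr0 //; apply/eqP => e.
by case/eqP: ne; apply: code_inj.
Qed.

(** * The subfield F_q and polynomials invariant under its translations and homotheties *)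

Section FiniteField.
Variables (K : closedFieldType) (q : nat).
Hypotheses (q_gt1 : (1 < q)%N) (q_pchar : [pchar K].-nat q).

Let q_gt0 : (0 < q)%N. Proof. exact: ltnW. Qed.

Definition Fq : seq K := sval (closed_field_poly_normal ('X^q - 'X)).

Lemma size_XqX : size ('X^q - 'X : {poly K}) = q.+1.
Proof. by rewrite size_polyDl ?size_polyXn // size_polyN size_polyX ltnS. Qed.

Lemma prod_Fq : \prod_(a <- Fq) ('X - a%:P) = 'X^q - 'X.
Proof.
rewrite /Fq; case: closed_field_poly_normal => r /= {1}->.
rewrite lead_coefDl ?size_polyN ?size_polyX ?size_polyXn //.
by rewrite lead_coefXn scale1r.
Qed.

Lemma mem_Fq a : (a \in Fq) = (a ^+ q == a).
Proof.
by rewrite -root_prod_XsubC prod_Fq rootE !hornerE subr_eq0.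
Qed.

Lemma q_eq0 : q%:R = 0 :> K.
Proof.
have : pdiv q \in [pchar K] by apply: (pnatPpi q_pchar); rewrite pi_pdiv.
by move=> pc; apply/eqP; rewrite -(dvdn_pcharf pc) pdiv_dvd.
Qed.

(** T^q - T is separable, because its derivative is -1. *)
Lemma Fq_uniq : uniq Fq.
Proof.
rewrite -separable_prod_XsubC prod_Fq separable_poly.unlock derivB derivXn derivX.
rewrite -mulr_natr -polyC_natr q_eq0 mulr0 sub0r.
by rewrite -[X in coprimep _ X]scaleN1r coprimepZr ?coprimep1 // oppr_eq0 oner_eq0.
Qed.

Lemma size_Fq : size Fq = q.
Proof. by apply/eq_add_S; rewrite -size_XqX -prod_Fq size_prod_XsubC. Qed.

Lemma Fq0 : 0 \in Fq.
Proof. by rewrite mem_Fq expr0n eqn0Ngt q_gt0. Qed.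

(** A root count replaces cyclicity of the multiplicative group: if r is the remainder of i modulo q
    - 1 and r > 0, then T^r - 1 would have q - 1 > r roots. *)
Lemma dvdn_pred_q i :
  {in Fq, forall t, t != 0 -> t ^+ i = 1} -> (q.-1 %| i)%N.
Proof.
move=> ti; have ti' : {in Fq, forall t, t != 0 -> t ^+ (i %% q.-1) = 1}.
  move=> t Ft nzt; rewrite -(ti t Ft nzt) {2}(divn_eq i q.-1) exprD mulnC exprM.
  suff -> : t ^+ q.-1 = 1 by rewrite expr1n mul1r.
  by apply: (mulfI nzt); rewrite -exprS prednK // mulr1; apply/eqP; rewrite -mem_Fq.
rewrite /dvdn; apply: contraT; rewrite -lt0n => r_gt0.
have rq : (i %% q.-1 < q.-1)%N by rewrite ltn_mod -ltnS prednK.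
have nz : 'X^(i %% q.-1) - 1 != 0 :> {poly K}.
  by rewrite -size_poly_eq0 size_XnsubC.
have Us : uniq (rem 0 Fq) by rewrite rem_uniq ?Fq_uniq.
have := max_poly_roots nz _ Us; rewrite size_XnsubC // size_rem ?Fq0 // size_Fq.
rewrite ltnS leqNgt rq; apply; apply/allP => t; rewrite mem_rem_uniq ?Fq_uniq // inE.
by move=> /andP[nzt Ft]; rewrite rootE !hornerE ti' ?subrr.
Qed.

Lemma scale_invariant_coef (P : {poly K}) i :
  {in Fq, forall t, t != 0 -> P \Po (t *: 'X) = P} -> P`_i != 0 -> (q.-1 %| i)%N.
Proof.
move=> Pinv nzPi; apply: dvdn_pred_q => t Ft nzt; apply: (mulIf nzPi).
by rewrite mul1r -coef_comp_scaleX Pinv.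
Qed.

(** T^q - z^(q-1) T has exactly the F_q-multiples of z as roots and is invariant under translation
    by them. Coefficients lie in a ring over K so that z may be an indeterminate. *)
Lemma Fq_translation_invariant (R : idomainType) (f : {rmorphism K -> R}) (z : R)
    (Q : {poly R}) : z != 0 ->
  {in Fq, forall a, Q \Po ('X + (f a * z)%:P) = Q} ->
  exists g, Q = g \Po ('X^q - z ^+ q.-1 *: 'X).
Proof.
move=> nzz Qinv; set U := 'X^q - _.
have sz : (size (z ^+ q.-1 *: 'X : {poly R}) < size ('X^q : {poly R}))%N.
  by rewrite size_polyXn ltnS (leq_trans (size_scale_leq _ _)) // size_polyX.
apply: (@translation_invariant_comp _ [seq f a * z | a <- Fq]).
- by rewrite map_inj_uniq ?Fq_uniq // => a b /(mulIf nzz) /fmorph_inj.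
- by apply/mapP; exists 0; rewrite ?Fq0 // rmorph0 mul0r.
- by rewrite monicE lead_coefDl ?size_polyN // lead_coefXn.
- by rewrite size_polyDl ?size_polyN // size_polyXn size_map size_Fq.
- by rewrite !hornerE expr0n eqn0Ngt q_gt0 ?mulr0 subr0.
- move=> _ /mapP[a Fa ->]; rewrite /U rmorphB rmorphXn /= comp_polyZ !comp_polyX.
  have ch : [pchar {poly R}].-nat q := rmorph_pchar_nat (@polyC _) (rmorph_pchar_nat f q_pchar).
  rewrite exprDn_pchar // -polyC_exp exprMn -rmorphXn /=.
  move: Fa; rewrite mem_Fq => /eqP ->; rewrite scalerDr -[z ^+ q.-1 *: _%:P]mul_polyC -polyCM.
  have -> : z ^+ q.-1 * (f a * z) = f a * z ^+ q by rewrite mulrCA -exprSr prednK.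
  by rewrite opprD addrACA subrr addr0.
by move=> _ /mapP[a Fa ->]; apply: Qinv.
Qed.

End FiniteField.

(** * Forms restricted to lines *)

Section HomogeneousForms.
Variables (K : fieldType).
Implicit Types (F : {mpoly K[3]}) (y z : K).

Lemma coef_ev_X F y z i :
  (ev (@polyC K) 'X y%:P z%:P F)`_i =
  \sum_(m <- msupp F) F@_m * (y ^+ m i1 * z ^+ m i2) * (m i0 == i)%:R.
Proof.
rewrite ev_sum coef_sum; apply: eq_bigr => m _.
by rewrite -!polyC_exp coefCM -mulrA -polyCM coefMC coefXn eq_sym [_%:R * _]mulrC mulrA.
Qed.

Definition line_restriction F : {poly K} := ev (@polyC K) 'X 1 0 F.

Lemma line_restrictionE F : line_restriction F = ev (@polyC K) 'X 1%:P 0%:P F.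
Proof. by []. Qed.

Section Homogeneous.
Variables (d : nat) (F : {mpoly K[3]}).
Hypothesis Fd : F \is d.-homog.

Lemma size_ev_X y z : (size (ev (@polyC K) 'X y%:P z%:P F) <= d.+1)%N.
Proof.
apply/leq_sizeP => i lt; rewrite coef_ev_X big_seq big1 // => m /(homog_mdeg3 Fd) e.
by rewrite (_ : (m i0 == i) = false) ?mulr0 //; apply/eqP; lia.
Qed.

(** Only the monomial X^d reaches degree d, so this coefficient depends on neither y nor z. *)
Lemma coefd_ev_X y z : (ev (@polyC K) 'X y%:P z%:P F)`_d = ev idfun 1 0 0 F.
Proof.
rewrite coef_ev_X ev_sum big_seq [RHS]big_seq; apply: eq_bigr => m /(homog_mdeg3 Fd) e.
rewrite expr1n mul1r !expr0n /= -mulrA; congr (_ * _).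
have [e0|ne] := eqVneq (m i0) d.
  have [-> ->] : m i1 = 0%N /\ m i2 = 0%N by lia.
  by rewrite !eqxx !mulr1.
rewrite mulr0; have [e1|_] := eqVneq (m i1) 0%N; last by rewrite mul0r.
have [e2|_] := eqVneq (m i2) 0%N; last by rewrite mulr0.
by case/eqP: ne; rewrite -e e1 e2 !addn0.
Qed.

(** F(T, 1, 0) and F(1, T, 0) are reciprocal polynomials; symmetry in X and Y will make
    [line_restriction] palindromic. *)
Lemma coef_line_restriction_rev i : (i <= d)%N ->
  (line_restriction F)`_i = (ev (@polyC K) 1 'X 0 F)`_(d - i).
Proof.
move=> led; rewrite coef_ev_X ev_sum coef_sum big_seq [RHS]big_seq.
apply: eq_bigr => m /(homog_mdeg3 Fd) e; rewrite !expr1n !mul1r -mulrA.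
rewrite coefCM; congr (_ * _).
have [e2|n2] := eqVneq (m i2) 0%N; last first.
  by rewrite !expr0n (negbTE n2) mulr0 mul0r coef0.
rewrite e2 !expr0 mul1r mulr1 coefXn; congr (_%:R); apply/eqP/eqP; lia.
Qed.

(** By homogeneity, a monomial free of Z is determined by its exponent of X, so no such monomials
    can cancel each other on the line Z = 0. *)
Lemma line_restriction_eq0 : line_restriction F = 0 -> exists G, F = pZ K * G.
Proof.
move=> P0; have Fm0 m : m \in msupp F -> (0 < m i2)%N.
  move=> Fm; rewrite lt0n; apply/eqP => m2.
  have := congr1 (fun p : {poly K} => p`_(m i0)) P0.
  rewrite coef_ev_X coef0 (bigD1_seq m) ?msupp_uniq //= m2 eqxx !expr1n !mulr1.
  rewrite big_seq_cond big1 ?addr0.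
    by move/eqP; apply/negP; rewrite -mcoeff_msupp.
  move=> m' /andP[Fm' ne]; have [e2|n2] := eqVneq (m' i2) 0%N; last first.
    by rewrite expr0n (negbTE n2) mulr0 mulr0 mul0r.
  rewrite (_ : (m' i0 == m i0) = false) ?mulr0 //; apply/eqP => e0.
  case/eqP: ne; apply: mnm3P => //; last by rewrite m2.
  by have := homog_mdeg3 Fd Fm; have := homog_mdeg3 Fd Fm'; lia.
exists (\sum_(m <- msupp F) F@_m *: 'X_[m - U_(i2)]).
rewrite [LHS]mpolyE mulr_sumr big_seq [RHS]big_seq; apply: eq_bigr => m /Fm0 m2.
rewrite -scalerAr -mpolyXD addmC submK //.
by apply/mnm_lepP => i; rewrite mnm1E; case: eqP => [<-|].
Qed.

End Homogeneous.
End HomogeneousForms.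

(** * Uniqueness *)

Section ReflectionInvariants.
Variables (K : closedFieldType) (q : nat).
Hypotheses (q_gt1 : (1 < q)%N) (q_pchar : [pchar K].-nat q).
Implicit Types F : {mpoly K[3]}.

Let q_gt0 : (0 < q)%N. Proof. exact: ltnW. Qed.
Local Notation Fq := (Fq K q).

(* Generators of GL(3,q), each acting with trivial multiplier. *)
Record refl_invariant F : Prop := ReflInvariant {
  inv_scaleZ : forall (S : comNzRingType) (f : {rmorphism K -> S}) x y z t,
    t \in Fq -> t != 0 -> ev f x y (f t * z) F = ev f x y z F;
  inv_shearXZ : forall (S : comNzRingType) (f : {rmorphism K -> S}) x y z a,
    a \in Fq -> ev f (x + f a * z) y z F = ev f x y z F;
  inv_swapXZ : forall (S : comNzRingType) (f : {rmorphism K -> S}) x y z,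
    ev f z y x F = ev f x y z F;
  inv_swapYZ : forall (S : comNzRingType) (f : {rmorphism K -> S}) x y z,
    ev f x z y F = ev f x y z F }.

Definition mx3 a00 a01 a02 a10 a11 a12 a20 a21 a22 : 'M[K]_3 := \matrix_(i, j)
  nth 0 (nth [::] [:: [:: a00; a01; a02]; [:: a10; a11; a12]; [:: a20; a21; a22]] i) j.

Lemma mx3_Fq a00 a01 a02 a10 a11 a12 a20 a21 a22 :
  all (fun a => a \in Fq) [:: a00; a01; a02; a10; a11; a12; a20; a21; a22] ->
  forall i j, in_Fq q (mx3 a00 a01 a02 a10 a11 a12 a20 a21 a22 i j).
Proof.
move=> /= /and5P[h1 h2 h3 h4 /and5P[h5 h6 h7 h8 /andP[h9 _]]] i j.
rewrite /in_Fq -mem_Fq // mxE.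
by case: i => [[|[|[|//]]] ?]; case: j => [[|[|[|//]]] ?].
Qed.

Lemma det_mx3 a00 a01 a02 a10 a11 a12 a20 a21 a22 :
  \det (mx3 a00 a01 a02 a10 a11 a12 a20 a21 a22) =
  a00 * (a11 * a22 - a12 * a21) - a01 * (a10 * a22 - a12 * a20)
    + a02 * (a10 * a21 - a11 * a20).
Proof. by rewrite det3 !mxE. Qed.

(** The multiplier is chosen before the ring and the point, so its value may be found on one test
    line and then used everywhere. *)
Lemma semi_invariant_ev F a00 a01 a02 a10 a11 a12 a20 a21 a22 :
  PGL3q_invariant q F ->
  all (fun a => a \in Fq) [:: a00; a01; a02; a10; a11; a12; a20; a21; a22] ->
  a00 * (a11 * a22 - a12 * a21) - a01 * (a10 * a22 - a12 * a20)
    + a02 * (a10 * a21 - a11 * a20) != 0 ->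
  exists2 lam : K, lam != 0 &
  forall (S : comNzRingType) (f : {rmorphism K -> S}) x y z,
    ev f (f a00 * x + f a01 * y + f a02 * z) (f a10 * x + f a11 * y + f a12 * z)
      (f a20 * x + f a21 * y + f a22 * z) F = f lam * ev f x y z F.
Proof.
move=> Finv /mx3_Fq AFq; rewrite -det_mx3 => nzA.
have [lam nz e] := Finv _ AFq nzA; exists lam => // S f x y z.
by rewrite -evZ -e ev_mx_subst !mxE.
Qed.

Lemma Fq1 : 1 \in Fq. Proof. by rewrite mem_Fq // expr1n. Qed.
Lemma FqN1 : -1 \in Fq. Proof. by rewrite mem_Fq // exprqN // expr1n. Qed.

(* A reflection fixes some F_q-rational line pointwise; F is nonzero on it, so the multiplier is 1. *)
Lemma semi_invariant_refl F :
  PGL3q_invariant q F -> line_restriction F != 0 -> refl_invariant F.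
Proof.
move=> Finv nzL; rewrite /line_restriction in nzL.
have F01 := (Fq0 K q_gt1, Fq1, FqN1).
have one lam (P : {poly K}) : P != 0 -> P = lam%:P * P -> lam = 1.
  by move=> nzP e; apply: polyC_inj; apply: (mulIf nzP); rewrite -e mul1r.
have swap_nz (lam : K) (P Q : {poly K}) : P != 0 -> P = lam%:P * Q -> Q != 0.
  by move=> nzP e; apply: contra nzP => /eqP Q0; rewrite e Q0 mulr0.
have simp := (rmorph0, rmorph1, rmorphN1, mul0r, mulr0, mul1r, addr0, add0r, mulN1r).
have sgn := (oppr0, subr0, sub0r, mulr1, mul1r, mulr0, mul0r, addr0, add0r).
split.
- move=> S f x y z t Ft nzt.
  have [||lam nz e] := @semi_invariant_ev F 1 0 0 0 1 0 0 0 t Finv.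
  + by rewrite /= !F01 Ft.
  + by rewrite !sgn.
  have E := e _ (@polyC K) 'X 1 0; rewrite !simp in E.
  have l1 := one _ _ nzL E.
  by have := e _ f x y z; rewrite l1 !simp.
- move=> S f x y z a Fa.
  have [||lam nz e] := @semi_invariant_ev F 1 0 a 0 1 0 0 0 1 Finv.
  + by rewrite /= !F01 Fa.
  + by rewrite !sgn oner_eq0.
  have E := e _ (@polyC K) 'X 1 0; rewrite !simp in E.
  have l1 := one _ _ nzL E.
  by have := e _ f x y z; rewrite l1 !simp.
- move=> S f x y z.
  (* The swap fixes the line X = Z pointwise. This shear carries that line to Z = 0 and so shows
     that F is not zero on it. *)
  have [||mu nzmu e1] := @semi_invariant_ev F 1 0 0 0 1 0 (-1) 0 1 Finv.
  + by rewrite /= !F01.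
  + by rewrite !sgn oner_eq0.
  have E1 := e1 _ (@polyC K) 'X 1 'X; rewrite !simp addNr in E1.
  have [||lam nz e] := @semi_invariant_ev F 0 0 1 0 1 0 1 0 0 Finv.
  + by rewrite /= !F01.
  + by rewrite !sgn oppr_eq0 oner_eq0.
  have E := e _ (@polyC K) 'X 1 'X; rewrite !simp in E.
  have l1 := one _ _ (swap_nz _ _ _ nzL E1) E.
  by have := e _ f x y z; rewrite l1 !simp.
move=> S f x y z.
have [||mu nzmu e1] := @semi_invariant_ev F 1 0 0 0 1 0 0 (-1) 1 Finv.
+ by rewrite /= !F01.
+ by rewrite !sgn oner_eq0.
have E1 := e1 _ (@polyC K) 'X 1 1; rewrite !simp addNr in E1.
have [||lam nz e] := @semi_invariant_ev F 1 0 0 0 0 1 0 1 0 Finv.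
+ by rewrite /= !F01.
+ by rewrite !sgn oppr_eq0 oner_eq0.
have E := e _ (@polyC K) 'X 1 1; rewrite !simp in E.
have l1 := one _ _ (swap_nz _ _ _ nzL E1) E.
by have := e _ f x y z; rewrite l1 !simp.
Qed.

Lemma refl_invariantB F G c :
  refl_invariant F -> refl_invariant G -> refl_invariant (F - c *: G).
Proof.
move=> [f1 f2 f3 f4] [g1 g2 g3 g4].
split=> S f x y z *; rewrite !rmorphB /= !evZ.
- by rewrite f1 ?g1.
- by rewrite f2 ?g2.
- by rewrite f3 g3.
- by rewrite f4 g4.
Qed.

Section Consequences.
Variable F : {mpoly K[3]}.
Hypothesis Finv : refl_invariant F.
Variables (S : comNzRingType) (f : {rmorphism K -> S}).
Implicit Types x y z : S.

Lemma inv_swapXY x y z : ev f y x z F = ev f x y z F.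
Proof. by rewrite (inv_swapXZ Finv) (inv_swapYZ Finv) (inv_swapXZ Finv). Qed.

Lemma inv_scaleX x y z t : t \in Fq -> t != 0 -> ev f (f t * x) y z F = ev f x y z F.
Proof. by move=> Ft nzt; rewrite (inv_swapXZ Finv) (inv_scaleZ Finv) // (inv_swapXZ Finv). Qed.

Lemma inv_shearXY x y z a : a \in Fq -> ev f (x + f a * y) y z F = ev f x y z F.
Proof. by move=> Fa; rewrite (inv_swapYZ Finv) (inv_shearXZ Finv) // (inv_swapYZ Finv). Qed.

Lemma inv_shearZ x y z a b :
  a \in Fq -> b \in Fq -> ev f x y (z + f a * x + f b * y) F = ev f x y z F.
Proof.
move=> Fa Fb; rewrite (inv_swapXZ Finv) inv_shearXY // (inv_shearXZ Finv) //.
exact: inv_swapXZ.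
Qed.

End Consequences.

(** * Invariant forms of low degree on the line Z = 0 *)

Section LowDegree.
Variables (d : nat) (F : {mpoly K[3]}).
Hypotheses (Fd : F \is d.-homog) (Finv : refl_invariant F).
Local Notation P := (line_restriction F).

Lemma line_restriction_shift a : a \in Fq -> P \Po ('X + a%:P) = P.
Proof.
move=> Fa; rewrite comp_ev comp_polyX rmorph1 rmorph0.
by have := inv_shearXY Finv (@polyC K) 'X 1 0 Fa; rewrite mulr1.
Qed.

(** For an indeterminate z, F(T, 1, z) is invariant under T -> T + a z, hence a polynomial in T^q -
    z^(q-1) T; then z is set to 0. *)
Lemma line_restriction_comp_Xq : exists g, P = g \Po 'X^q.
Proof.
pose f := (@polyC {poly K} \o @polyC K).
pose Q := ev f 'X 1 'X%:P F.
have nzX : 'X != 0 :> {poly K} by rewrite polyX_eq0.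
have [a Fa|g eg] := @Fq_translation_invariant K q q_gt1 q_pchar {poly K} (@polyC K) 'X Q nzX.
  rewrite /Q rmorph_ev /= comp_polyX rmorph1 comp_polyC.
  have -> : ('X : {poly {poly K}}) + (a%:P * 'X)%:P = 'X + f a * 'X%:P by rewrite /f /= -polyCM.
  rewrite -[RHS](inv_shearXZ Finv f 'X 1 'X%:P Fa).
  by apply: eq_ev => c /=; rewrite comp_polyC.
pose ev0 := map_poly (horner_eval (0 : K)).
exists (ev0 g).
have -> : P = ev0 Q.
  rewrite /Q /ev0 rmorph_ev /= map_polyX rmorph1 map_polyC /= /horner_eval hornerX.
  by apply: eq_ev => c /=; rewrite map_polyC /= /horner_eval hornerC.
rewrite eg /ev0 map_comp_poly rmorphB rmorphXn /= map_polyX.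
by rewrite map_polyZ map_polyX /= /horner_eval hornerXn expr0n -subn1 subn_eq0 leqNgt q_gt1 scale0r subr0.
Qed.

Lemma line_restriction_coef i : P`_i != 0 -> (q * q.-1 %| i)%N.
Proof.
move=> nz; rewrite Gauss_dvd ?coprimenP //.
rewrite andbC (@scale_invariant_coef K q q_gt1 q_pchar P) //=.
  have [g eg] := line_restriction_comp_Xq; move: nz; rewrite eg comp_poly_Xn //.
  rewrite coef_poly; case: ifP => _; last by rewrite eqxx.
  by case: ifP => // _; rewrite eqxx.
move=> t Ft nzt; rewrite comp_ev comp_polyX rmorph1 rmorph0 -mul_polyC.
exact: (inv_scaleX Finv).
Qed.

(** P vanishes at 0, hence to order q(q-1) there and, by translation, at each of the q elements of
    F_q. So a non-zero P has degree at least q^3 - q^2. *)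
Lemma line_restriction_eq0_low : (d < q ^ 3 - q)%N -> ev idfun 1 0 0 F = 0 -> P = 0.
Proof.
move=> ltd F100; apply/eqP; apply: contraT => nzP.
have P0 : P`_0 = 0.
  by rewrite -horner_coef0 horner_ev hornerX !hornerC (inv_swapXY Finv).
have rev i : (i <= d)%N -> P`_i = P`_(d - i).
  by move=> led; rewrite (coef_line_restriction_rev Fd) // (inv_swapXY Finv).
have dvX : ('X - 0%:P) ^+ (q * q.-1) %| P.
  rewrite subr0; apply/dvdpP; exists (drop_poly (q * q.-1) P).
  rewrite -[LHS](poly_take_drop (q * q.-1)) -[RHS]add0r; congr (_ + _).
  apply/polyP => i; rewrite coef_take_poly coef0; case: ltnP => // lt.
  apply/eqP; apply: contraT => nzi; have := line_restriction_coef nzi.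
  case: (posnP i) => [i0|i_gt0 /dvdn_leq]; first by rewrite i0 P0 eqxx in nzi.
  by move=> /(_ i_gt0); rewrite leqNgt lt.
have dv : {in Fq, forall a, ('X - a%:P) ^+ (q * q.-1) %| P}.
  move=> a Fa; have FNa : - a \in Fq.
    by rewrite mem_Fq // exprqN //; move: Fa; rewrite mem_Fq // => /eqP ->.
  rewrite -(line_restriction_shift FNa).
  have := dvdp_comp_poly ('X + (- a)%:P) dvX.
  by rewrite subr0 rmorphXn /= comp_polyX polyCN.
have := size_gt_root_multiplicities (Fq_uniq q_gt1 q_pchar) nzP dv.
rewrite size_Fq // => ltP.
have lead : P`_(size P).-1 != 0 by rewrite -lead_coefE lead_coef_eq0.
have led : ((size P).-1 <= d)%N.
  by rewrite -subn1 leq_subLR add1n line_restrictionE size_ev_X.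
(* By the palindromic symmetry, d - deg P is also the index of a non-zero coefficient, so a positive
   multiple of q(q-1). Added to q^3 - q^2 this gives d >= q^3 - q. *)
have nzr := lead; rewrite (rev _ led) in nzr.
have := line_restriction_coef nzr.
case: (posnP (d - (size P).-1)) => [e|pos /(dvdn_leq pos)].
  by move: nzr; rewrite e P0 eqxx.
move: ltd ltP led pos; clear; nia.
Qed.

End LowDegree.
End ReflectionInvariants.

(** * Vanishing of invariant forms and identification with the DGZ form *)

Section Uniqueness.
Variables (K : closedFieldType) (q : nat).
Hypotheses (q_gt1 : (1 < q)%N) (q_pchar : [pchar K].-nat q).
Implicit Types F : {mpoly K[3]}.

Let q_gt0 : (0 < q)%N. Proof. exact: ltnW. Qed.
Local Notation Fq := (Fq K q).

(** Repetitions are kept when x and y are dependent over F_q, so the length is always q^2. *)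
Definition Fq_span (x y : K) := [seq a * x + b * y | a <- Fq, b <- Fq].

Lemma size_Fq_span x y : size (Fq_span x y) = (q ^ 2)%N.
Proof. by rewrite size_allpairs size_Fq. Qed.

(** A relation u x + v y = 0 over F_q and its q-th power form a linear system whose determinant is
    [lin2]. *)
Lemma Fq_span_uniq x y : lin2 q x y != 0 -> uniq (Fq_span x y).
Proof.
move=> nzl; apply: allpairs_uniq => [||[a b] [a' b']]; try exact: Fq_uniq.
move=> /allpairsP[[a1 b1] /= [Fa Fb [-> ->]]] /allpairsP[[a2 b2] /= [Fa' Fb' [-> ->]]] e.
have zero u v : u ^+ q = u -> v ^+ q = v -> u * x + v * y = 0 -> u = 0 /\ v = 0.
  move=> eu ev0 E; have Eq : u * x ^+ q + v * y ^+ q = 0.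
    by rewrite -{1}eu -{1}ev0 -!exprMn -exprqD // E expr0n eqn0Ngt q_gt0.
  split; apply: (mulIf nzl); rewrite mul0r /lin2.
    have -> : u * (x * y ^+ q - x ^+ q * y) =
      (u * x + v * y) * y ^+ q - (u * x ^+ q + v * y ^+ q) * y by ring.
    by rewrite E Eq !mul0r subrr.
  have -> : v * (x * y ^+ q - x ^+ q * y) =
    (u * x ^+ q + v * y ^+ q) * x - (u * x + v * y) * x ^+ q by ring.
  by rewrite E Eq !mul0r subrr.
move: Fa Fb Fa' Fb'; rewrite !mem_Fq // => /eqP Fa /eqP Fb /eqP Fa' /eqP Fb'.
have [|||/eqP ea /eqP eb] := zero (a1 - a2) (b1 - b2).
- by rewrite exprqB // Fa Fa'.
- by rewrite exprqB // Fb Fb'.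
- by apply/eqP; rewrite !mulrBl addrACA -opprD subr_eq0 e.
by move: ea eb; rewrite !subr_eq0 => /eqP -> /eqP ->.
Qed.

(** For y outside F_q, F(T, y, 1) has the q^2 elements of the span of y and 1 as roots of
    multiplicity at least q - 1. Its coefficient of T^d is F(1, 0, 0) = 0, so its degree is below
    q^2 (q-1) and it vanishes. *)
Lemma refl_invariant_eq0 d F : F \is d.-homog -> refl_invariant q F ->
  (d <= q ^ 3 - q ^ 2)%N -> line_restriction F = 0 -> F = 0.
Proof.
move=> Fd Finv led L0.
have vanish y : y \notin Fq -> ev (@polyC K) 'X y%:P 1%:P F = 0.
  move=> ny; apply/eqP; apply: contraT => nzQ.
  pose N := ev (@polyC K) 1 y%:P 'X F.
  have Ninv : {in Fq, forall t, t != 0 -> N \Po (t *: 'X) = N}.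
    move=> t Ft nzt; rewrite comp_ev comp_polyX rmorph1 comp_polyC -mul_polyC.
    exact: (inv_scaleZ Finv).
  have dvN : 'X^(q.-1) %| N.
    apply/dvdpP; exists (drop_poly q.-1 N).
    rewrite -[LHS](poly_take_drop q.-1) -[RHS]add0r; congr (_ + _).
    apply/polyP => i; rewrite coef_take_poly coef0; case: ltnP => // lt.
    apply/eqP; apply: contraT => nzi.
    have := scale_invariant_coef q_gt1 q_pchar Ninv nzi.
    case: (posnP i) => [i0 _|i_gt0 /(dvdn_leq i_gt0)]; last by rewrite leqNgt lt.
    have e : N`_i = (line_restriction F).[y].
      by rewrite i0 -horner_coef0 /line_restriction !horner_ev !hornerX !hornerC (inv_swapXY Finv).
    by rewrite e L0 horner0 eqxx in nzi.
  have dv : {in Fq_span y 1, forall c, ('X - c%:P) ^+ q.-1 %| ev (@polyC K) 'X y%:P 1%:P F}.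
    move=> _ /allpairsP[[a b] /= [Fa Fb ->]].
    have opp c : c \in Fq -> - c \in Fq.
      by rewrite !mem_Fq // exprqN // => /eqP ->.
    (* By [inv_shearZ], F(1, y, T) is unchanged when T becomes T - c, so its factor T^(q-1) yields
       (T - c)^(q-1). *)
    have := dvdp_comp_poly ('X - (a * y + b * 1)%:P) dvN.
    rewrite rmorphXn /= comp_polyX comp_ev comp_polyX rmorph1 comp_polyC.
    have -> : 'X - (a * y + b * 1)%:P = 'X + (- b)%:P * 1 + (- a)%:P * y%:P.
      by rewrite !mulr1 -polyCM mulNr !polyCN polyCD opprD addrCA addrC -addrA addrC.
    by rewrite (inv_shearZ Finv) ?opp // (inv_swapXZ Finv) polyC1.
  have := @size_gt_root_multiplicities K _ (Fq_span y 1) q.-1 _ nzQ dv.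
  have nzl : lin2 q y 1 != 0.
    by rewrite /lin2 expr1n !mulr1 subr_eq0 eq_sym -mem_Fq.
  rewrite Fq_span_uniq // size_Fq_span => /(_ isT) lt.
  have lead : (ev (@polyC K) 'X y%:P 1%:P F)`_d = 0.
    by rewrite (coefd_ev_X Fd) -(coefd_ev_X Fd 1 0) -line_restrictionE L0 coef0.
  have le1 := size_ev_X Fd y 1.
  have le2 : (size (ev (@polyC K) 'X y%:P 1%:P F) <= d)%N.
    rewrite leqNgt; apply: contra nzQ => gt; rewrite -lead_coef_eq0 lead_coefE.
    have -> : size (ev (@polyC K) 'X y%:P 1%:P F) = d.+1 by apply/eqP; rewrite eqn_leq le1.
    by rewrite lead.
  by move: lt; rewrite ltnNge (leq_trans le2) // (leq_trans led) //; move: q_gt0; clear; nia.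
have nzZ : pZ K != 0.
  by apply/eqP => /(congr1 (ev idfun 0 0 1)) /eqP; rewrite ev_pZ rmorph0 oner_eq0.
have nzYZ : lin2 q (pY K) (pZ K) != 0.
  have nz := lin2_XY_neq0 q_gt1 q_pchar; apply: contra nz => /eqP e; apply/eqP.
  have := congr1 (ev (@mpolyC 3 K) 0 (pX K) (pY K)) e.
  by rewrite rmorph_lin2 rmorph0 /= ev_pY ev_pZ.
(* The points that [vanish] does not reach have z = 0 or y/z in F_q; the factor multiplied to F is
   zero there. *)
apply/eqP; have : F * (pZ K * lin2 q (pY K) (pZ K)) = 0.
  apply: ev_eq0 => x y z; rewrite !rmorphM /= rmorph_lin2 /= ev_pY ev_pZ.
  have [->|nzz] := eqVneq z 0; first by rewrite mul0r mulr0.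
  have E : ev idfun x y z F = z ^+ d * ev idfun (x / z) (y / z) 1 F.
    by rewrite -(ev_homog _ _ _ _ _ Fd) mulr1 ![z * (_ / z)]mulrC !divfK.
  have [Fyz|nyz] := boolP (y / z \in Fq).
    suff -> : lin2 q y z = 0 by rewrite !mulr0.
    move: Fyz; rewrite mem_Fq // exprMn exprVn => /eqP e.
    have Ey : y ^+ q = y / z * z ^+ q by rewrite -e divfK ?expf_neq0.
    by rewrite /lin2 Ey mulrAC divfK // subrr.
  have := congr1 (fun p => p.[x / z]) (vanish _ nyz).
  by rewrite horner_ev hornerX !hornerC E => ->; rewrite mulr0 mul0r.
by move/eqP; rewrite !mulf_eq0 (negbTE nzZ) (negbTE nzYZ) !orbF.
Qed.

Lemma line_restriction_dgz : line_restriction (dgz K q) != 0.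
Proof.
apply/eqP => /(congr1 (fun p => p.[0])).
rewrite horner_ev ev_dickson3 hornerX hornerC horner0 /dickson3 quot2_at0 //.
rewrite /orbit3 quot2_at0 // !expr1n !mulr0 !expr0n expn_eq0 eqn0Ngt q_gt0 mulr0 subr0 add0r.
rewrite expr0n -subn1 subn_eq0 leqNgt q_gt1 addr0 => /eqP.
by rewrite oner_eq0.
Qed.

Lemma dgz_refl_invariant : refl_invariant q (dgz K q).
Proof.
apply: semi_invariant_refl => //; last exact: line_restriction_dgz.
exact: dgz_invariant.
Qed.

Lemma refl_invariant_vertex_eq0 d F : F \is d.-homog -> refl_invariant q F ->
  (d <= q ^ 3 - q ^ 2)%N -> ev idfun 1 0 0 F = 0 -> F = 0.
Proof.
move=> Fd Finv led F100; apply: (refl_invariant_eq0 Fd Finv led).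
by apply: (line_restriction_eq0_low q_gt1 q_pchar Fd Finv _ F100); move: led q_gt1; clear; nia.
Qed.

Lemma dgz_neq0 : dgz K q != 0.
Proof.
by apply: contra line_restriction_dgz => /eqP ->; rewrite /line_restriction rmorph0.
Qed.

Lemma dgz_vertex : ev idfun 1 0 0 (dgz K q) != 0.
Proof.
apply: contra dgz_neq0 => /eqP e; apply/eqP.
exact: refl_invariant_vertex_eq0 (dgz_homog q_gt1 q_pchar) dgz_refl_invariant (leqnn _) e.
Qed.

(** Otherwise F is a scalar multiple of Z, but swapping X and Z moves the line Z = 0. *)
Lemma irreducible_invariant_line F : mirreducible F -> PGL3q_invariant q F ->
  forall d, F \is d.-homog -> line_restriction F != 0.
Proof.
move=> [nc irr] Finv d Fd; apply/eqP => /(line_restriction_eq0 Fd)[G eF].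
have [|cG] := irr _ _ eF; first by rewrite /mconstant msizeX mdeg1.
have [c eG] : exists c, G = c%:MP by exists G@_0; apply: msize1_polyC.
have [||lam nzl e] := @semi_invariant_ev K q q_gt1 F 0 0 1 0 1 0 1 0 0 Finv.
- by rewrite /= !mem_Fq // !expr1n expr0n eqn0Ngt q_gt0 !eqxx.
- by rewrite !(oppr0, mulr0, mul0r, mulr1, mul1r, subr0, add0r, sub0r) oppr_eq0 oner_eq0.
have := e _ idfun 0 0 1; rewrite /= eF eG !rmorphM /= !evC !ev_pZ /=.
rewrite !(mul0r, mulr0, mul1r, addr0) => /esym/eqP; rewrite mulf_eq0 (negbTE nzl) /= => /eqP c0.
by move: nc; rewrite eF eG c0 mpolyC0 mulr0 /mconstant msize0.
Qed.

Lemma irreducible_invariant_dgz d F : F \is d.-homog -> (d < q ^ 3 - q)%N ->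
  mirreducible F -> PGL3q_invariant q F ->
  exists2 c : K, c != 0 & F = c *: dgz K q.
Proof.
move=> Fd ltd Firr Finv; have nzL := irreducible_invariant_line Firr Finv Fd.
have Frefl := semi_invariant_refl q_gt1 q_pchar Finv nzL.
set P := line_restriction F in nzL.
have nz100 : ev idfun 1 0 0 F != 0.
  apply: contra nzL => /eqP e; apply/eqP.
  exact: (line_restriction_eq0_low q_gt1 q_pchar Fd Frefl ltd e).
have nzPd : P`_d != 0 by rewrite /P line_restrictionE (coefd_ev_X Fd).
have sP : size P = d.+1.
  apply/eqP; rewrite eqn_leq {1}/P line_restrictionE (size_ev_X Fd) /=.
  by rewrite ltnNge; apply: contra nzPd => le; rewrite nth_default.
(* With P = g(T^q), the translations by a in F_q pass to g because a^q = a. Hence g = h(T^q - T) and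
   deg P = q^2 deg h. *)
have q2d : (q ^ 2 %| d)%N.
  have [g eg] := line_restriction_comp_Xq q_gt1 q_pchar Frefl.
  have [a Fa|h eh] := @Fq_translation_invariant K q q_gt1 q_pchar K idfun 1 g (oner_neq0 _).
    have Xq_inj (u v : {poly K}) : u \Po 'X^q = v \Po 'X^q -> u = v.
      move=> e; apply/eqP; rewrite -subr_eq0 -(@comp_poly_eq0 _ _ 'X^q) ?size_polyXn ?ltnS //.
      by rewrite comp_polyB e subrr.
    apply: Xq_inj; rewrite -eg -(line_restriction_shift Frefl Fa) eg -!comp_polyA.
    congr (_ \Po _); rewrite rmorphD rmorphXn /= !comp_polyX comp_polyC /= mulr1.
    rewrite exprDn_pchar; first by rewrite -polyC_exp; move: Fa; rewrite mem_Fq // => /eqP ->.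
    exact: (rmorph_pchar_nat (@polyC K) q_pchar).
  have := congr1 (fun p : {poly K} => (size p).-1) eg.
  rewrite -/P sP /= eh !size_comp_poly size_polyXn /=.
  rewrite expr1n scale1r size_XqX // => ->.
  by rewrite -mulnA dvdn_mull.
have qd : (q * q.-1 %| d)%N by exact: (line_restriction_coef q_gt1 q_pchar Frefl nzPd).
have d_gt0 : (0 < d)%N.
  have nzF : F != 0 by apply: contra nz100 => /eqP ->; rewrite rmorph0.
  have /= sF : d = (msize F).-1 := dhomog_uniq nzF Fd (dhomog_msize Fd).
  by rewrite sF ltn_predRL ltnNge; exact: (proj1 Firr).
have ed : d = (q ^ 3 - q ^ 2)%N.
  have : (q ^ 2 * q.-1 %| d)%N.
    rewrite Gauss_dvd; last by rewrite coprimeXl // coprimenP.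
    by rewrite q2d (dvdn_trans _ qd) // dvdn_mull.
  move=> /dvdnP[k dk]; move: d_gt0 ltd; rewrite dk.
  case: k dk => [|[|k]] dk; first by rewrite mul0n.
    by rewrite mul1n => _ _; move: q_gt0; clear; nia.
  by move=> _; move: q_gt1; clear; nia.
pose c := ev idfun 1 0 0 F / ev idfun 1 0 0 (dgz K q).
exists c; first by rewrite mulf_neq0 ?invr_eq0 ?dgz_vertex.
apply/eqP; rewrite -subr_eq0; apply/eqP.
apply: (@refl_invariant_vertex_eq0 d); rewrite ?ed //.
- by rewrite rpredB // ?rpredZ -?ed // ed dgz_homog.
- exact: refl_invariantB Frefl dgz_refl_invariant.
by rewrite rmorphB /= evZ /= divfK ?dgz_vertex // subrr.
Qed.

End Uniqueness.

(** * Irreducibility *)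

(** The indeterminate is prime, so its N factors are shared out between p and r one at a time. *)
Lemma split_Xn_mul (R : idomainType) N (p r e : {poly R}) : p * r = 'X^N * e ->
  exists k l p' r', [/\ (k + l)%N = N, p = 'X^k * p' & r = 'X^l * r'].
Proof.
elim: N p r => [|N IH] p r epr.
  by exists 0, 0, p, r; rewrite !mul1r.
have divX (u : {poly R}) : u.[0] = 0 -> exists v, u = 'X * v.
  by move/eqP/factor_theorem => [v ->]; exists v; rewrite subr0 mulrC.
have : p.[0] * r.[0] = 0 by rewrite -hornerM epr hornerM hornerXn expr0n mul0r.
have nzX : 'X != 0 :> {poly R} by rewrite polyX_eq0.
move/eqP; rewrite mulf_eq0 => /orP[/eqP/divX[v ev0]|/eqP/divX[v ev0]].
  have [|k [l [p' [r' [<- e1 ->]]]]] := IH v r.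
    by apply: (mulfI nzX); rewrite !mulrA -ev0 -exprS.
  by exists k.+1, l, p', r'; rewrite ev0 e1 exprS mulrA.
have [|k [l [p' [r' [<- -> e1]]]]] := IH p v.
  by apply: (mulfI nzX); rewrite mulrCA -ev0 mulrA -exprS.
by exists k, l.+1, p', r'; rewrite addnS ev0 e1 exprS mulrA.
Qed.

(** Writing p = (T - x)^m g with g(x) non-zero, p(x + T^e) has order exactly e m at 0. *)
Lemma ramified_order_le (K : fieldType) (p w : {poly K}) x e k : (0 < e)%N -> p != 0 ->
  p \Po (x%:P + 'X^e) = 'X^k * w -> (k <= e * mup x p)%N.
Proof.
move=> e_gt0 nzp epw; set m := mup x p.
have /dvdpP[g eg] : ('X - x%:P) ^+ m %| p by rewrite -mup_geq.
have ngx : g.[x] != 0.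
  apply/negP => /factor_theorem[g1 eg1].
  have : (m.+1 <= mup x p)%N by rewrite mup_geq // eg eg1 -mulrA -exprS dvdp_mull.
  by rewrite ltnn.
rewrite leqNgt; apply/negP => lt; move: epw.
rewrite eg comp_polyM rmorphXn rmorphB /= comp_polyX comp_polyC addrAC subrr add0r.
rewrite -exprM mulrC -(subnK lt) addnS -addSn addnC exprD -mulrA.
have nzXn : 'X^(e * m) != 0 :> {poly K} by rewrite expf_neq0 ?polyX_eq0.
move=> /(mulfI nzXn)/(congr1 (fun u : {poly K} => u.[0])).
rewrite horner_comp hornerD hornerC hornerM !hornerXn !expr0n eqn0Ngt e_gt0 addr0 mul0r.
by move/eqP; rewrite (negbTE ngx).
Qed.

(** * The Dickson forms as polynomials in Z *)

Section DicksonInZ.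
Variables (R : idomainType) (q : nat) (x y : R).
Hypothesis q_gt1 : (1 < q)%N.

Let q_gt0 : (0 < q)%N. Proof. exact: ltnW. Qed.

Local Notation V := (orbit3 q x%:P y%:P 'X).

Lemma orbit3_polyE :
  V = 'X^(q ^ 2) - quot2 q x y *: 'X^q + lin2 q x y ^+ q.-1 *: 'X.
Proof.
by rewrite /orbit3 -(rmorph_quot2 (@polyC R)) -(rmorph_lin2 (@polyC R)) /= -polyC_exp !mul_polyC.
Qed.

Lemma size_orbit3 : size V = (q ^ 2).+1.
Proof.
rewrite orbit3_polyE -addrA size_polyDl size_polyXn // ltnS.
rewrite (leq_trans (size_polyD _ _)) // geq_max size_polyN.
rewrite !(leq_trans (size_scale_leq _ _)) ?size_polyXn ?size_polyX //; move: q_gt1; clear; nia.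
Qed.

Lemma orbit3_monic : V \is monic.
Proof.
have n1 : (q ^ 2)%N == q = false by apply/eqP; move: q_gt1; clear; nia.
have n2 : (q ^ 2)%N == 1%N = false by apply/eqP; move: q_gt1; clear; nia.
rewrite monicE lead_coefE size_orbit3 orbit3_polyE coefD coefB !coefZ !coefXn coefX.
by rewrite eqxx n1 n2 !mulr0 subr0 addr0.
Qed.

Lemma dickson3_monic : dickson3 q x%:P y%:P 'X \is monic.
Proof.
have sz : (size (V ^+ q.-1) = (q ^ 2 * q.-1).+1)%N.
  by rewrite polySpred ?expf_neq0 ?monic_neq0 ?orbit3_monic // size_exp size_orbit3.
rewrite /dickson3 -(rmorph_quot2 (@polyC R)) -rmorphXn /= monicE lead_coefDr.
  by rewrite -monicE monic_exp ?orbit3_monic.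
rewrite sz (leq_ltn_trans (size_polyC_leq1 _)) // ltnS muln_gt0.
by move: q_gt1; clear; case: q => [|[|k]] //; rewrite expn_gt0.
Qed.

End DicksonInZ.

(** * A common zero of two factors by elimination of Z *)

Section CommonZero.
Variables (K : closedFieldType) (q : nat).
Hypotheses (q_gt1 : (1 < q)%N) (q_pchar : [pchar K].-nat q).
Variables G H : {mpoly K[3]}.
Hypothesis GH : G * H = dgz K q.

Let q_gt0 : (0 < q)%N. Proof. exact: ltnW. Qed.

Definition zpoly (F : {mpoly K[3]}) x y : {poly K} := ev (@polyC K) x%:P y%:P 'X F.

(** A family of polynomials in Z along the parametrized curve (u(s), v(s)), with coefficients in
    K[s]. *)
Definition zpoly_on (F : {mpoly K[3]}) (u v : {poly K}) : {poly {poly K}} :=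
  ev (@polyC {poly K} \o @polyC K) u%:P v%:P 'X F.

Lemma map_zpoly_on F u v s :
  map_poly (horner_eval s) (zpoly_on F u v) = zpoly F u.[s] v.[s].
Proof.
rewrite /zpoly_on rmorph_ev /= map_polyX !map_polyC.
by apply: eq_ev => c /=; rewrite map_polyC /= /horner_eval hornerC.
Qed.

Lemma zpolyM x y : zpoly G x y * zpoly H x y = dickson3 q x%:P y%:P 'X.
Proof. by rewrite -rmorphM /= GH ev_dickson3. Qed.

Lemma zpoly_onM u v : zpoly_on G u v * zpoly_on H u v = dickson3 q u%:P v%:P 'X.
Proof. by rewrite -rmorphM /= GH ev_dickson3. Qed.

(** The product of the two polynomials is monic in Z, so their leading coefficients are units of
    K[s]. *)
Lemma lead_zpoly_on_neq0 u v s :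
  (lead_coef (zpoly_on G u v)).[s] != 0 /\ (lead_coef (zpoly_on H u v)).[s] != 0.
Proof.
have : (lead_coef (zpoly_on G u v)).[s] * (lead_coef (zpoly_on H u v)).[s] = 1.
  rewrite -hornerM -lead_coefM zpoly_onM; have := dickson3_monic u v q_gt1.
  by rewrite monicE => /eqP ->; rewrite hornerC.
by move/eqP => e; split; apply: contraTneq e => ->; rewrite ?mul0r ?mulr0 eq_sym oner_eq0.
Qed.

(** The leading coefficients have no zero along the line (s x, s y), which joins the origin at s = 0
    to (x, y) at s = 1. *)
Lemma size_zpoly x y :
  size (zpoly G x y) = size (zpoly G 0 0) /\ size (zpoly H x y) = size (zpoly H 0 0).
Proof.
pose u := x *: 'X; pose v := y *: 'X.
have sG s : size (zpoly G u.[s] v.[s]) = size (zpoly_on G u v).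
  by rewrite -map_zpoly_on size_map_poly_id0 //; case: (lead_zpoly_on_neq0 u v s).
have sH s : size (zpoly H u.[s] v.[s]) = size (zpoly_on H u v).
  by rewrite -map_zpoly_on size_map_poly_id0 //; case: (lead_zpoly_on_neq0 u v s).
have := (sG 0, sG 1, sH 0, sH 1).
by rewrite /u /v !hornerZ !hornerX !mulr0 !mulr1 => -[[[-> ->] ->] ->].
Qed.

Lemma no_root_const (P : {poly K}) s t : (forall x, P.[x] != 0) -> P.[s] = P.[t].
Proof.
move=> nr; have /size_poly1P[c _ ->] : size P == 1.
  by apply: contraT => /closed_rootP[x]; rewrite rootE (negbTE (nr x)).
by rewrite !hornerC.
Qed.

Lemma mconstantP (F : {mpoly K[3]}) k : (forall x y z, ev idfun x y z F = k) -> mconstant F.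
Proof.
move=> Fk; have : F - k%:MP = 0.
  by apply: ev_eq0 => x y z; rewrite rmorphB /= Fk evC subrr.
by move/eqP; rewrite subr_eq0 => /eqP ->; rewrite /mconstant msizeC; case: (_ == 0).
Qed.

Definition zres x y := resultant (zpoly G x y) (zpoly H x y).

(** The resultant commutes with specialization of s because the leading coefficients survive. *)
Lemma zres_on u v : exists r : {poly K}, forall s, r.[s] = zres u.[s] v.[s].
Proof.
exists (resultant (zpoly_on G u v) (zpoly_on H u v)) => s.
have [nzG nzH] := lead_zpoly_on_neq0 u v s.
by rewrite -/(horner_eval s _) map_resultant // !map_zpoly_on.
Qed.

(* A polynomial in (x, y) vanishing at the origin is not constant on every line avoiding the origin. *)
Lemma zres_zero : zres 0 0 = 0 -> exists x y, (x != 0) || (y != 0) /\ zres x y = 0.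
Proof.
move=> r00; have [c0|nzc] := eqVneq (zres 0 1) 0.
  by exists 0, 1; rewrite oner_eq0 orbT.
have [r0 er0] := zres_on 'X 0.
(* This provides t non-zero with [zres t 0] different from [zres 0 1]. On the line (t s, 1 - s),
   which misses the origin, the resultant is then non-constant and has a zero. *)
have nzp : 'X * (r0 - (zres 0 1)%:P) != 0.
  rewrite mulf_neq0 ?polyX_eq0 //; apply/eqP => /(congr1 (fun p : {poly K} => p.[0])).
  rewrite hornerD hornerN hornerC er0 hornerX horner0 r00 sub0r => /eqP.
  by rewrite oppr_eq0 (negbTE nzc).
have /closed_nonrootP[t] := nzp; rewrite rootE hornerM hornerX mulf_eq0 negb_or => /andP[nzt].
rewrite hornerD hornerN hornerC er0 hornerX horner0 subr_eq0 => ne.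
have [r er] := zres_on (t *: 'X) (1 - 'X).
have /closed_rootP[s] : size r != 1%N.
  apply/negP => /size_poly1P[k _ ek]; have := er 0; have := er 1; move: ne.
  rewrite ek !hornerZ !hornerD !hornerN !hornerX !hornerC mulr0 subr0 mulr1 subrr.
  by move=> ne -> e; rewrite e eqxx in ne.
rewrite rootE er hornerZ hornerD hornerN hornerX hornerC => /eqP rs.
exists (t * s), (1 - s); split=> //; have [s1|_] := eqVneq (1 - s) 0; last by rewrite orbT.
by move/eqP: s1; rewrite subr_eq0 => /eqP <-; rewrite mulr1 nzt.
Qed.

(** If G were free of Z, a zero of G would annihilate the monic polynomial [dickson3] over some (x,
    y). Having no zero, G is constant on every line through the origin. *)
Lemma zpoly_nonconstant : ~~ mconstant G -> (1 < size (zpoly G 0 0))%N.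
Proof.
apply: contraR; rewrite -leqNgt => le1.
have Ez x y z : ev idfun x y z G = ev idfun x y 0 G.
  have -> : ev idfun x y z G = (zpoly G x y).[z].
    by rewrite horner_ev !hornerC hornerX.
  have -> : ev idfun x y 0 G = (zpoly G x y).[0].
    by rewrite horner_ev !hornerC hornerX.
  by rewrite (size1_polyC (_ : size (zpoly G x y) <= 1)%N) ?hornerC // (size_zpoly x y).1.
apply: (@mconstantP _ (ev idfun 0 0 0 G)) => x y z; rewrite Ez.
pose P := ev (@polyC K) (x *: 'X) (y *: 'X) 0 G.
have EP s : P.[s] = ev idfun (x * s) (y * s) 0 G.
  by rewrite horner_ev !hornerZ hornerX hornerC.
have := EP 1; have := EP 0; rewrite !mulr1 !mulr0 => <- <-.
apply: no_root_const => s; rewrite EP; apply/eqP => e0.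
have z0 : zpoly G (x * s) (y * s) = 0.
  by apply: closed_poly_eq0 => w; rewrite horner_ev !hornerC hornerX Ez.
have := zpolyM (x * s) (y * s); rewrite z0 mul0r => /esym/eqP; apply/negP.
exact: monic_neq0 (dickson3_monic _ _ q_gt1).
Qed.

(** Over x = y = 0 the DGZ form is a power of Z, so 0 is the only possible root of a factor. *)
Lemma zpoly_root0 : ~~ mconstant G -> (zpoly G 0 0).[0] = 0.
Proof.
move=> /zpoly_nonconstant lt; have /closed_rootP[z rz] : size (zpoly G 0 0) != 1%N.
  by rewrite neq_ltn lt orbT.
suff z0 : z = 0 by move/eqP: rz; rewrite z0.
have := congr1 (fun p : {poly K} => p.[z]) (zpolyM 0 0); rewrite hornerM (eqP rz) mul0r.
rewrite -[RHS]/(horner_eval z _) rmorph_dickson3 /= /horner_eval !hornerC hornerX.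
have e0 k : (0 < k)%N -> 0 ^+ k = 0 :> K by case: k => // k _; rewrite expr0n.
have q1_gt0 : (0 < q.-1)%N by rewrite -subn1 subn_gt0.
rewrite /dickson3 /orbit3 quot2_at0 // /lin2 (e0 (_ * _)%N) ?muln_gt0 ?q1_gt0 // e0 //.
by rewrite !mul0r subrr e0 // mul0r subr0 addr0 add0r => /esym/eqP; rewrite !expf_eq0 => /andP[_ /andP[_ /eqP]].
Qed.

End CommonZero.

(** Both factors vanish at the origin, so their resultant vanishes at (0, 0), hence also at another
    (x, y), over which they share a root. *)
Lemma common_zero (K : closedFieldType) (q : nat) (G H : {mpoly K[3]}) :
  (1 < q)%N -> [pchar K].-nat q -> G * H = dgz K q -> ~~ mconstant G -> ~~ mconstant H ->
  exists x y z, [/\ (x != 0) || (y != 0), ev idfun x y z G = 0 & ev idfun x y z H = 0].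
Proof.
move=> q_gt1 q_pchar GH ncG ncH; have HG : H * G = dgz K q by rewrite mulrC.
have common x y : zres G H x y = 0 ->
    exists z, ev idfun x y z G = 0 /\ ev idfun x y z H = 0.
  move/eqP; rewrite resultant_eq0 => lt.
  have /closed_rootP[z] : size (gcdp (zpoly G x y) (zpoly H x y)) != 1%N by rewrite neq_ltn lt orbT.
  rewrite root_gcd !rootE !horner_ev !hornerC hornerX => /andP[/eqP ? /eqP ?].
  by exists z.
have [|x [y [nz /common[z [? ?]]]]] := zres_zero q_gt1 GH; last by exists x, y, z.
apply/eqP; rewrite resultant_eq0; have nzg : gcdp (zpoly G 0 0) (zpoly H 0 0) != 0.
  rewrite gcdp_eq0 negb_and; apply/orP; left.
  by rewrite -size_poly_gt0 (ltn_trans _ (zpoly_nonconstant q_gt1 GH ncG)).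
apply: (@root_size_gt1 _ 0) => //; rewrite root_gcd !rootE.
by rewrite (zpoly_root0 q_gt1 GH ncG) (zpoly_root0 q_gt1 HG ncH) eqxx.
Qed.

(** * Common zeros lie on F_q-rational lines *)

Section SingularPoints.
Variables (K : closedFieldType) (q : nat).
Hypotheses (q_gt1 : (1 < q)%N) (q_pchar : [pchar K].-nat q).
Implicit Types (x y z : K) (G H : {mpoly K[3]}).

Let q_gt0 : (0 < q)%N. Proof. exact: ltnW. Qed.
Let q1_gt0 : (0 < q.-1)%N. Proof. by rewrite -subn1 subn_gt0. Qed.
Local Notation Fq := (Fq K q).

Lemma quot2_at0r x : quot2 q x 0 = x ^+ (q.-1 * q).
Proof.
rewrite /quot2 big_ord_recl /= muln0 expr0 mulr1 subn0.
rewrite big1 ?addr0 // => i _; rewrite expr0n muln_eq0 /=.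
by rewrite (gtn_eqF q1_gt0) mulr0.
Qed.

(** When x and y are non-zero, [lin2] = 0 gives x^(q-1) = y^(q-1), and [quot2] becomes q + 1 = 1
    times a non-zero power of y. *)
Lemma quot2_lin2_eq0 x y :
  lin2 q x y = 0 -> quot2 q x y = 0 -> ~~ ((x != 0) || (y != 0)).
Proof.
have [->|nzx] := eqVneq x 0.
  by rewrite quot2_at0 // => _ /eqP; rewrite expf_eq0 => /andP[_ ->].
have [->|nzy] := eqVneq y 0.
  by rewrite quot2_at0r => _ /eqP; rewrite expf_eq0 (negbTE nzx) andbF.
move=> l0; have e : x ^+ q.-1 = y ^+ q.-1.
  apply: (mulfI (mulf_neq0 nzx nzy)).
  rewrite mulrAC -exprS -mulrA -exprS prednK //; apply/esym/eqP.
  by rewrite -subr_eq0 -/(lin2 q x y) l0.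
have -> : quot2 q x y = \sum_(i < q.+1) (y ^+ q.-1) ^+ q.
  apply: eq_bigr => i _; rewrite !exprM e -exprD subnK // -ltnS; exact: ltn_ord.
rewrite sumr_const card_ord -mulr_natr -natr1 q_eq0 // add0r mulr1 => /eqP.
by rewrite !expf_eq0 (negbTE nzy) !andbF.
Qed.

(* dC/dZ = - V^(q-2) * lin2^(q-1) because every other exponent of Z in V is divisible by p. *)
Lemma common_zero_orbit3 G H x y z : G * H = dgz K q ->
  ev idfun x y z G = 0 -> ev idfun x y z H = 0 ->
  orbit3 q x y z = 0 \/ lin2 q x y = 0.
Proof.
move=> GH G0 H0.
have evz F : (zpoly F x y).[z] = ev idfun x y z F by rewrite horner_ev !hornerC hornerX.
have : (dickson3 q x%:P y%:P 'X)^`().[z] = 0.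
  rewrite -(zpolyM GH) derivM hornerD !hornerM !evz G0 H0 mulr0 mul0r addr0 //.
have dV : (orbit3 q x%:P y%:P 'X)^`() = (lin2 q x y ^+ q.-1)%:P.
  rewrite orbit3_polyE derivD derivB !derivZ !derivXn derivX.
  have ch n : ('X^n *+ q : {poly K}) = 0.
    by rewrite -mulr_natr -polyC_natr q_eq0 // polyC0 mulr0.
  by rewrite {2}expnS mulrnA mulrnAC !ch ?mul0rn !scaler0 subrr add0r alg_polyC.
rewrite /dickson3 -(rmorph_quot2 (@polyC K)) -rmorphXn /= derivD derivC add0r.
rewrite deriv_exp dV -mulr_natr -polyC_natr !hornerM !hornerC horner_exp.
have -> : (orbit3 q x%:P y%:P 'X).[z] = orbit3 q x y z.
  by rewrite -/(horner_eval z _) rmorph_orbit3 /= /horner_eval !hornerC hornerX.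
have -> : (q.-1)%:R = -1 :> K.
  by apply/eqP; rewrite -addr_eq0 natr1 prednK // q_eq0.
rewrite mulrN1 => /eqP; rewrite oppr_eq0 mulf_eq0 !expf_eq0.
by move=> /orP[/andP[_ /eqP]|/andP[_ /eqP]]; [right|left].
Qed.

(** The span already supplies q^2 distinct roots of a monic polynomial of degree q^2. *)
Lemma root_orbit3 x y z : lin2 q x y != 0 -> orbit3 q x y z = 0 -> z \in Fq_span q x y.
Proof.
move=> nzl Vz; apply: contraT => nz.
have Vm := orbit3_monic x y q_gt1.
have evV w : (orbit3 q x%:P y%:P 'X).[w] = orbit3 q x y w.
  by rewrite -/(horner_eval w _) rmorph_orbit3 /= /horner_eval !hornerC hornerX.
have := @max_poly_roots _ _ (z :: Fq_span q x y) (monic_neq0 Vm).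
rewrite /= nz Fq_span_uniq // size_Fq_span // size_orbit3 // ltnn; apply=> //.
rewrite rootE evV Vz eqxx /=; apply/allP => _ /allpairsP[[a b] /= [Fa Fb ->]].
rewrite rootE evV -(mulrI_eq0 _ (mulfI nzl)) orbit3_moore //.
(* A singular matrix sends (x, y, 0) to (x, y, a x + b y), so the Moore determinant vanishes
   there. *)
have := @moore3_linear K q 2 1 0 0 0 1 0 a b 0 x y 0 q_pchar.
rewrite !(mul1r, mul0r, addr0, add0r, mulr0, subrr) /= => ->; first by rewrite oppr0 addr0 mul0r.
by rewrite -!mem_Fq // Fa Fb Fq0 // Fq1.
Qed.

(** The point lies on Z = a X + b Y, on Y = 0, or on X = a Y with a = x / y in F_q; in each case A
    maps the line Z = 0 onto that line. *)
Lemma move_to_line x y z : (x != 0) || (y != 0) ->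
  orbit3 q x y z = 0 \/ lin2 q x y = 0 ->
  exists A : 'M[K]_3, [/\ forall i j, in_Fq q (A i j), \det A != 0 &
    exists x' y', (x' != 0) || (y' != 0) /\
      forall F, ev idfun x' y' 0 (mx_subst A F) = ev idfun x y z F].
Proof.
move=> nz Vl; have F01 := (Fq0 K q_gt1, @Fq1 K q q_gt1).
have simp := (oppr0, mulr0, mul0r, mulr1, mul1r, subr0, add0r, sub0r, addr0).
have [l0|nzl] := eqVneq (lin2 q x y) 0; last first.
  have : z \in Fq_span q x y by apply: root_orbit3 => //; case: Vl => // l0; rewrite l0 eqxx in nzl.
  move=> /allpairsP[[a b] /= [Fa Fb ->]].
  exists (mx3 1 0 0 0 1 0 a b 1); split; first by apply: mx3_Fq; rewrite //= !F01 Fa Fb.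
    by rewrite det_mx3 !simp oner_eq0.
  by exists x, y; split=> // F; rewrite ev_mx_subst !mxE /= !simp.
have [y0|nzy] := eqVneq y 0.
  exists (mx3 1 0 0 0 0 1 0 1 0); split; first by apply: mx3_Fq; rewrite //= !F01.
    by rewrite det_mx3 !simp oppr_eq0 oner_eq0.
  exists x, z; move: nz; rewrite y0 eqxx orbF => ->; split=> // F.
  by rewrite ev_mx_subst !mxE /= !simp.
have Fa : x / y \in Fq.
  rewrite mem_Fq // expr_div_n eqr_div ?expf_neq0 //.
  by move/eqP: l0; rewrite /lin2 subr_eq0 => /eqP ->.
exists (mx3 0 (x / y) 1 0 1 0 1 0 0); split; first by apply: mx3_Fq; rewrite //= !F01 Fa.
  by rewrite det_mx3 !simp oppr_eq0 oner_eq0.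
exists z, y; rewrite nzy orbT; split=> // F.
by rewrite ev_mx_subst !mxE /= !simp divfK.
Qed.

End SingularPoints.

Lemma orbit3_factor (S : comNzRingType) q (x y z : S) : (0 < q)%N ->
  orbit3 q x y z =
  z * (z ^+ (q ^ 2).-1 - quot2 q x y * z ^+ q.-1 + lin2 q x y ^+ q.-1).
Proof.
move=> q_gt0; have e k : (0 < k)%N -> z ^+ k = z * z ^+ k.-1 by case: k => // k _; rewrite exprS.
rewrite /orbit3 (e (q ^ 2)%N) ?expn_gt0 ?q_gt0 // (e q) //; ring.
Qed.

(** * Local analysis at a point of the curve on Z = 0 *)

Section Unibranch.
Variables (K : closedFieldType) (q : nat).
Hypotheses (q_gt1 : (1 < q)%N) (q_pchar : [pchar K].-nat q).
Variables (x y : K).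
Hypotheses (nz_xy : (x != 0) || (y != 0)) (c0 : quot2 q x y = 0).

Let q_gt0 : (0 < q)%N. Proof. exact: ltnW. Qed.
Let q1_gt0 : (0 < q.-1)%N. Proof. by rewrite -subn1 subn_gt0. Qed.

Let y_neq0 : y != 0.
Proof.
apply: contraTneq nz_xy => y0; move/eqP: c0.
by rewrite y0 quot2_at0r // expf_eq0 eqxx orbF => /andP[_ ->].
Qed.

Let nzl : lin2 q x y != 0.
Proof.
apply/eqP => l0; have := quot2_lin2_eq0 q_gt1 q_pchar l0 c0.
by rewrite nz_xy.
Qed.

(** In X, the product of [lin2] and [quot2] has the non-zero constant derivative y^(q^2), so [quot2]
    has no multiple root. *)
Lemma quot2_simple_root : exists2 c1 : {poly K},
  quot2 q 'X y%:P = ('X - x%:P) * c1 & c1.[x] != 0.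
Proof.
have /factor_theorem[c1 ec] : root (quot2 q 'X y%:P) x.
  by rewrite rootE -/(horner_eval x _) rmorph_quot2 /= /horner_eval hornerX hornerC c0.
exists c1; first by rewrite mulrC.
apply/negP => /eqP c1x; have := lin2_quot2 q_gt0 ('X : {poly K}) y%:P.
move/(congr1 (fun p : {poly K} => p^`().[x])).
rewrite ec mulrA derivM hornerD !hornerM c1x hornerXsubC subrr !mulr0 mul0r addr0.
have ch n : ('X^n *+ q ^ 2 : {poly K}) = 0.
  by rewrite -mulr_natr -polyC_natr natrX q_eq0 // expr0n polyC0 mulr0.
rewrite derivB !derivM -!polyC_exp !derivC derivX derivXn ch !mul0r !mulr0 !addr0 subr0 mul1r.
by rewrite hornerC => /esym/eqP; rewrite expf_eq0 (negbTE y_neq0) andbF.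
Qed.

(** Three nested indeterminates: s innermost, z in the middle, and the outer one T, whose exponent
    records the weight. *)
Let R := {poly {poly K}}.
Let fT := (@polyC R \o (@polyC {poly K} \o @polyC K)).
Let sT : {poly R} := ('X : {poly K})%:P%:P.
Let zT : {poly R} := ('X : R)%:P.
(* Weights: X - x has weight q - 1 and Z has weight q. *)
Let gT (F : {mpoly K[3]}) : {poly R} := ev fT (fT x + sT * 'X^(q.-1)) (fT y) (zT * 'X^q) F.
Let spec (s t : K) := horner_eval s \o horner_eval (t%:P : {poly K}).

Lemma map_gT s t F : map_poly (spec s t) (gT F) =
  ev (@polyC K) (x%:P + s *: 'X^(q.-1)) y%:P (t *: 'X^q) F.
Proof.
have sc c : map_poly (spec s t) (fT c) = c%:P.
  by rewrite /fT /= map_polyC /spec /= /horner_eval !hornerC.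
rewrite /gT rmorph_ev rmorphD !rmorphM /= !sc !map_polyXn.
rewrite !map_polyC /spec /= /horner_eval !hornerC !hornerX hornerC !mul_polyC.
by apply: eq_ev => c; apply: sc.
Qed.

(** Both summands have weight at least q(q-1): [quot2] contains X - x and is raised to the power q,
    [orbit3] contains Z and is raised to the power q - 1. *)
Lemma dickson3_weight : exists e : {poly R},
  dickson3 q (fT x + sT * 'X^(q.-1)) (fT y) (zT * 'X^q) = 'X^(q * q.-1) * e.
Proof.
have [c1 ec _] := quot2_simple_root.
set Xt := fT x + _.
pose theta : {rmorphism {poly K} -> {poly R}} := horner_eval Xt \o map_poly fT.
have thC c : theta c%:P = fT c by rewrite /theta /= map_polyC /horner_eval hornerC.
have thX : theta 'X = Xt by rewrite /theta /= map_polyX /horner_eval hornerX.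
have -> : dickson3 q Xt (fT y) (zT * 'X^q) =
    (theta c1 * sT * 'X^(q.-1)) ^+ q + orbit3 q Xt (fT y) (zT * 'X^q) ^+ q.-1.
  rewrite /dickson3; congr (_ ^+ _ + _).
  have -> : quot2 q Xt (fT y) = theta (quot2 q 'X y%:P) by rewrite rmorph_quot2 thX thC.
  have -> : theta (quot2 q 'X y%:P) = (theta 'X - theta x%:P) * theta c1.
    by rewrite ec rmorphM rmorphB.
  rewrite thX thC.
  by rewrite /Xt addrAC subrr add0r mulrC mulrA.
rewrite orbit3_factor //; set E := (X in zT * 'X^q * X).
exists ((theta c1 * sT) ^+ q + (zT * E) ^+ q.-1).
by rewrite [_ * _ * E]mulrAC ![(_ * 'X^_) ^+ _]exprMn -!exprM (mulnC q.-1 q) -mulrDl mulrC.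
Qed.

(** Let G and H absorb T^k and T^l with k + l = q(q-1). If m and n are the orders of G(X, y, 0) at x
    and of G(x, y, Z) at 0, then k is at most (q-1) m and at most q n. For H likewise; as the orders
    of G and H add up to q and q - 1, all bounds are equalities. *)
Lemma dgz_unibranch (G H : {mpoly K[3]}) : G * H = dgz K q ->
  ev idfun x y 0 G = 0 -> ev idfun x y 0 H = 0 -> False.
Proof.
move=> GH G0 H0.
have eT : gT G * gT H = dickson3 q (fT x + sT * 'X^(q.-1)) (fT y) (zT * 'X^q).
  by rewrite -rmorphM /= GH ev_dickson3.
have [e ee] := dickson3_weight; rewrite ee in eT.
have [k [l [p' [r' [ekl eG eH]]]]] := split_Xn_mul eT.
pose xp F : {poly K} := ev (@polyC K) 'X y%:P 0 F.
have [c1 ec nzc1] := quot2_simple_root.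
have xpM : xp G * xp H = ('X - x%:P) ^+ q * c1 ^+ q.
  rewrite -exprMn -ec -rmorphM /= GH ev_dickson3 /dickson3 orbit3_factor // mul0r.
  by rewrite expr0n (gtn_eqF q1_gt0) addr0.
have zpM : zpoly G x y * zpoly H x y =
    ('X - 0%:P) ^+ q.-1 * ('X^((q ^ 2).-1) + (lin2 q x y ^+ q.-1)%:P) ^+ q.-1.
  rewrite (zpolyM GH) -exprMn /dickson3 orbit3_factor //.
  rewrite -(rmorph_quot2 (@polyC K)) -(rmorph_lin2 (@polyC K)) /= c0 polyC0.
  by rewrite expr0n (gtn_eqF q_gt0) add0r mul0r !subr0 polyC_exp.
have nzc : c1 != 0 by apply: contraNneq nzc1 => ->; rewrite horner0.
have nzx : xp G * xp H != 0 by rewrite xpM mulf_neq0 ?expf_neq0 ?polyXsubC_eq0.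
have nzz : zpoly G x y * zpoly H x y != 0.
  by rewrite (zpolyM GH) monic_neq0 // dickson3_monic.
move: (nzx) (nzz); rewrite !mulf_eq0 !negb_or => /andP[nzxG nzxH] /andP[nzzG nzzH].
have mx : (mup x (xp G) + mup x (xp H) = q)%N.
  rewrite -mupM // xpM mupMl ?mup_XsubCX ?eqxx //.
  by rewrite rootE horner_exp expf_neq0.
have mz : (mup 0 (zpoly G x y) + mup 0 (zpoly H x y) = q.-1)%N.
  rewrite -mupM // zpM mupMl ?mup_XsubCX ?eqxx //.
  rewrite rootE horner_exp expf_neq0 // hornerD hornerXn hornerC expr0n.
  rewrite (_ : (_ == 0)%N = false) ?add0r ?expf_neq0 //.
  by apply/eqP; move: q_gt1; clear; nia.
(* Setting s = 1, z = 0 restricts to Z = 0 with X = x + T^(q-1); setting s = 0, z = 1, as in [wz],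
   restricts to X = x with Z = T^q. *)
have wx F j w : xp F != 0 -> gT F = 'X^j * w -> (j <= q.-1 * mup x (xp F))%N.
  move=> nzF eF; apply: (@ramified_order_le _ _ (map_poly (spec 1 0) w)) => //.
  rewrite -(map_polyXn (spec 1 0) j) -rmorphM /= -eF map_gT.
  by rewrite comp_ev comp_polyX comp_polyC rmorph0 scale1r scale0r.
have wz F j w : zpoly F x y != 0 -> gT F = 'X^j * w -> (j <= q * mup 0 (zpoly F x y))%N.
  move=> nzF eF; apply: (@ramified_order_le _ _ (map_poly (spec 0 1) w)) => //.
  rewrite -(map_polyXn (spec 0 1) j) -rmorphM /= -eF map_gT.
  by rewrite comp_ev comp_polyX !comp_polyC scale1r scale0r addr0 add0r.
have pos F : ev idfun x y 0 F = 0 -> xp F != 0 -> (0 < mup x (xp F))%N.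
  move=> F0 nzF; rewrite -XsubC_dvd // dvdp_XsubCl rootE horner_ev hornerX !hornerC.
  by rewrite F0.
have := (wx _ _ _ nzxG eG, wx _ _ _ nzxH eH, wz _ _ _ nzzG eG, wz _ _ _ nzzH eH).
move=> [[[a1 a2] a3] a4].
have E1 : (q.-1 * mup x (xp G) = q * mup 0 (zpoly G x y))%N.
  have E2 : (q.-1 * mup x (xp G) + q.-1 * mup x (xp H) = q * q.-1)%N by rewrite -mulnDr mx mulnC.
  have E3 : (q * mup 0 (zpoly G x y) + q * mup 0 (zpoly H x y) = q * q.-1)%N by rewrite -mulnDr mz.
  by move: a1 a2 a3 a4 ekl E2 E3; clear; lia.
(* From (q-1) m = q n, q divides m; but 0 < m < q because H also passes through the point. *)
have : (q %| mup x (xp G))%N.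
  by rewrite -(@Gauss_dvdr _ q.-1) ?E1 ?dvdn_mulr // coprimenP.
move/(dvdn_leq (pos _ G0 nzxG)); rewrite leqNgt -mx => /negP; apply.
by rewrite -[X in (X < _)%N]addn0 ltn_add2l pos.
Qed.

End Unibranch.

Lemma dgz_irreducible (K : closedFieldType) (q : nat) :
  (1 < q)%N -> [pchar K].-nat q -> mirreducible (dgz K q).
Proof.
move=> q_gt1 q_pchar; have q1_gt0 : (0 < q.-1)%N by rewrite -subn1 subn_gt0.
split.
  apply/negP => /msize1_polyC e; have := dgz_vertex q_gt1 q_pchar.
  (* Scaling by 0 shows that a constant form of positive degree is zero. *)
  have := ev_homog idfun 0 0 0 0 (dgz_homog q_gt1 q_pchar).
  rewrite !mul0r e !evC expr0n subn_eq0 leq_exp2l // ltnn mul0r => ->.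
  by rewrite eqxx.
move=> G H GH; have [|ncG] := boolP (mconstant G); [by left | right].
apply: contraT => ncH; exfalso.
have [x [y [z [nz G0 H0]]]] := common_zero q_gt1 q_pchar (esym GH) ncG ncH.
have Vl := common_zero_orbit3 q_gt1 q_pchar (esym GH) G0 H0.
have [A [AFq nzA [x' [y' [nz' eA]]]]] := move_to_line q_gt1 q_pchar nz Vl.
have GH' : mx_subst A G * mx_subst A H = dgz K q.
  by rewrite -[RHS](mx_subst_dgz q_gt1 q_pchar AFq nzA) GH /mx_subst rmorphM.
(* On Z = 0 the DGZ form reduces to [quot2] to the power q. *)
have c0 : quot2 q x' y' = 0.
  have := ev_dickson3 idfun q x' y' 0; rewrite -[dickson3 _ _ _ _]/(dgz K q) -GH' rmorphM /= !eA G0 mul0r.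
  rewrite /dickson3 orbit3_factor ?(ltnW q_gt1) // mul0r expr0n (gtn_eqF q1_gt0) addr0.
  by move/esym/eqP; rewrite expf_eq0 => /andP[_ /eqP].
by apply: (dgz_unibranch q_gt1 q_pchar nz' c0 GH'); rewrite eA.
Qed.

Theorem mainTheorem6 (p n : nat) (K : closedFieldType) :
  prime p -> (0 < n)%N -> p \in [pchar K] ->
  (* K is an algebraic closure of F_p (hence of F_q): algebraically closed and
     every element lies in a finite subfield F_(p^m) *)
  (forall x : K, exists2 m : nat, (0 < m)%N & x ^+ (p ^ m) = x) ->
  let q := (p ^ n)%N in
  (exists F : {mpoly K[3]}, F \is (q ^ 3 - q ^ 2)%N.-homog /\ is_DGZ q F) /\
  (forall (d : nat) (F : {mpoly K[3]}),
     F != 0 -> F \is d.-homog -> (d < q ^ 3 - q)%N ->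
     (mirreducible F /\ PGL3q_invariant q F <-> is_DGZ q F)).
Proof.
move=> p_pr n_gt0 pK _ q.
have q_gt1 : (1 < q)%N by rewrite -(exp1n n) ltn_exp2r // prime_gt1.
have q_pchar : [pchar K].-nat q.
  by rewrite pnatX pnatE // pK.
split.
  exists (dgz K q); split; first exact: dgz_homog.
  by apply/is_DGZP => //; exists 1; rewrite ?oner_eq0 ?scale1r.
move=> d F nzF Fd ltd; split.
  by move=> [Firr Finv]; apply/is_DGZP => //; apply: irreducible_invariant_dgz Fd ltd Firr Finv.
move/(is_DGZP q_gt1 q_pchar) => [c nzc ->]; split.
  have [nc irr] := dgz_irreducible q_gt1 q_pchar; split.
    by rewrite /mconstant msizeZ.
  move=> G H e; have [|cG|] := irr (c^-1 *: G) H.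
  - by rewrite -scalerAl -e scalerA mulVf // scale1r.
  - by left; move: cG; rewrite /mconstant msizeZ // invr_eq0.
  by right.
move=> A AFq nzA; exists 1; rewrite ?oner_eq0 // scale1r.
by rewrite /mx_subst linearZ /= -/(mx_subst A _) mx_subst_dgz.
Qed.
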